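(* The matroids $V_1$, $V_2$, and $V_3$ each have characteristic set $\{2\}$. The matroids $P_1$, $P_2$, and $P_3$ each have characteristic set $(\mathcal{P}-\{3\})\cup\{0\}$, where $\mathcal{P}$ is the set of primes. Each of these six matroids is an excluded minor for $\mathcal{AC}_4$ (i.e., is not in $\mathcal{AC}_4$ while every proper minor is). Moreover, $V_2$ and $P_2$ are each isomorphic to their duals.
   Context: The characteristic set of a matroid $M$ is the set of $k$ such that $M$ is representable over some field of characteristic $k$ (with $k$ a prime or $0$). $\mathcal{AC}_4$ is the class of $\mathrm{GF}(4)$-representable matroids representable over some field of every characteristic. Let $\alpha\in\mathrm{GF}(4)$ satisfy $\alpha^2=\alpha+1$. $V_1,V_2,V_3,P_1,P_2,P_3$ are the column matroids over $\mathrm{GF}(4)$ of (rows separated by semicolons): $V_1$: $[1,0,0,1,0,1,1,1,1;\ 0,1,0,1,1,\alpha^2,\alpha^2,\alpha,0;\ 0,0,1,0,1,1,\alpha,1,\alpha]$. $V_2$: $[1,0,0,0,1,1,1,0;\ 0,1,0,0,\alpha^2,\alpha,\alpha,1;\ 0,0,1,0,\alpha,\alpha^2,\alpha,1;\ 0,0,0,1,\alpha^2,\alpha^2,\alpha,\alpha]$. $V_3$: $[1,0,0,0,1,0,1,1,1;\ 0,1,0,0,\alpha,1,\alpha^2,\alpha^2,1;\ 0,0,1,0,\alpha,1,\alpha,1,\alpha^2;\ 0,0,0,1,0,1,1,0,0]$. $P_1$: $[0,1,1,1,1,1,0,0,0;\ 0,1,\alpha,0,0,0,1,1,1;\ 1,0,0,1,\alpha,\alpha^2,1,\alpha,\alpha^2]$.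 $P_2$: $[1,0,0,0,1,0,1,1;\ 0,1,0,0,\alpha,1,1,1;\ 0,0,1,0,1,1,0,1;\ 0,0,0,1,\alpha^2,1,\alpha^2,0]$. $P_3$: $[0,1,1,1,1,1,1,0,0;\ 0,1,\alpha,\alpha^2,0,0,0,1,1;\ 1,0,0,0,1,\alpha,\alpha^2,1,\alpha]$. *)

(* Defs.v *)
From HB Require Import structures.
From mathcomp Require Import all_boot all_order all_algebra.
From mathcomp Require Import zify.

Set Implicit Arguments.
Unset Strict Implicit.
Unset Printing Implicit Defensive.

Import GRing.Theory.
Local Open Scope ring_scope.

(* The ground set is a subset of a fixed finite type, so that a matroid and   *)
(* all its minors live over the same type.                                    *)
Record matroid (T : finType) := Matroid {
  ground : {set T};
  indep : {set {set T}};
  indep_sub : forall I, I \in indep -> I \subset ground;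
  indep0 : set0 \in indep;
  indepS : forall I J : {set T}, I \subset J -> J \in indep -> I \in indep;
  indep_aug : forall I J, I \in indep -> J \in indep -> (#|I| < #|J|)%N ->
    exists2 x, x \in J :\: I & x |: I \in indep
}.

Definition bases (T : finType) (M : matroid T) : {set {set T}} :=
  [set B | maxset (mem (indep M)) B].

Section Matroid.
Variables (T : finType) (M : matroid T).

Lemma indep_extend (I J : {set T}) :
  I \in indep M -> J \in indep M -> (#|I| <= #|J|)%N ->
  exists K, [/\ K \in indep M, I \subset K, K \subset I :|: J & #|K| = #|J|].
Proof.
move: {2}(#|J| - #|I|)%N (erefl (#|J| - #|I|)%N) => n.
elim: n I => [|n IHn] I eqn iI iJ leIJ.
  exists I; split; rewrite ?subxx ?subsetUl //.
  by apply/eqP; rewrite eqn_leq leIJ -subn_eq0 eqn.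
have ltIJ : (#|I| < #|J|)%N by rewrite -subn_gt0 eqn.
have [x /setDP[xJ xI] ixI] := indep_aug iI iJ ltIJ.
have cxI : #|x |: I| = #|I|.+1 by rewrite cardsU1 xI.
have [||K [iK sK KS cK]] := IHn (x |: I) _ ixI iJ.
- by rewrite cxI subnS eqn.
- by rewrite cxI.
exists K; split=> //; first exact: subset_trans (subsetUr _ _) sK.
apply: subset_trans KS _; rewrite subUset subsetUr andbT.
by rewrite subUset subsetUl sub1set inE xJ orbT.
Qed.

Lemma bases_indep B : B \in bases M -> B \in indep M.
Proof. by rewrite inE => /maxsetp. Qed.

Lemma indep_le_basis I B : I \in indep M -> B \in bases M -> (#|I| <= #|B|)%N.
Proof.
move=> iI; rewrite inE => /maxsetP[iB maxB]; rewrite leqNgt; apply/negP => lt.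
have [x /setDP[_ xB] ixB] := indep_aug iB iI lt.
by move: xB; rewrite -(maxB _ ixB (subsetUr _ _)) setU11.
Qed.

Lemma bases_ex : exists B, B \in bases M.
Proof.
have [B mB _] := @maxset_exists _ (mem (indep M)) set0 (indep0 M).
by exists B; rewrite inE.
Qed.

Lemma card_basis I B : B \in bases M -> I \in indep M -> #|I| = #|B| ->
  I \in bases M.
Proof.
move=> bB iI cI; rewrite inE; apply/maxsetP; split=> // J iJ sIJ.
apply/eqP; rewrite eq_sym eqEcard sIJ cI; exact: indep_le_basis.
Qed.

Definition dual_indep : {set {set T}} :=
  [set I : {set T} | (I \subset ground M) &&
                     [exists B in bases M, [disjoint I & B]]].

Fact dual_sub I : I \in dual_indep -> I \subset ground M.
Proof. by rewrite inE => /andP[]. Qed.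

Fact dual0 : set0 \in dual_indep.
Proof.
rewrite inE sub0set; have [B bB] := bases_ex.
by apply/existsP; exists B; rewrite bB -setI_eq0 set0I eqxx.
Qed.

Fact dualS (I J : {set T}) : I \subset J -> J \in dual_indep -> I \in dual_indep.
Proof.
move=> sIJ; rewrite !inE => /andP[sJ /existsP[B /andP[bB dJB]]].
rewrite (subset_trans sIJ sJ); apply/existsP; exists B.
by rewrite bB (disjointWl sIJ dJB).
Qed.

Fact dual_aug (I J : {set T}) : I \in dual_indep -> J \in dual_indep ->
  (#|I| < #|J|)%N -> exists2 x, x \in J :\: I & x |: I \in dual_indep.
Proof.
rewrite !inE => /andP[sI /existsP[B /andP[bB dB]]].
case/andP=> sJ /existsP[D /andP[bD dD]] ltIJ.
have iDI : D :\: I \in indep M := indepS (subsetDl _ _) (bases_indep bD).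
have [K [iK sK KS cK]] :=
  indep_extend iDI (bases_indep bB) (indep_le_basis iDI bB).
have bK := card_basis bB iK cK.
have dIK : [disjoint I & K].
  apply/pred0P=> x /=; apply/negP=> /andP[xI /(subsetP KS)].
  by rewrite !inE xI /= => xB; rewrite (disjointFr dB xI) in xB.
have [sJK|/subsetPn[x xJI xK]] := boolP (J :\: I \subset K); last first.
  have /setDP[xJ xI] := xJI.
  exists x => //; rewrite inE subUset sub1set (subsetP sJ) // sI /=.
  apply/existsP; exists K; rewrite bK /=.
  apply/pred0P=> y /=; rewrite !inE.
  case: eqP => [->|_] /=; first exact/negbTE.
  by apply/negP=> /andP[yI]; rewrite (disjointFr dIK yI).
have le1 : (#|J :\: I :|: D :\: I| <= #|D|)%N.
  apply: leq_trans (indep_le_basis iK bD); apply: subset_leq_card.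
  by rewrite subUset sJK.
have dJD : (J :\: I) :&: (D :\: I) = set0.
  apply/setP=> x; rewrite !inE; case: (boolP (x \in J)) => [xJ|]; last first.
    by rewrite andbF.
  by rewrite (disjointFr dD xJ) !andbF.
have dIJD : (I :&: J) :&: (I :&: D) = set0.
  apply/setP=> x; rewrite !inE; case: (boolP (x \in J)) => [xJ|]; last first.
    by rewrite !andbF.
  by rewrite (disjointFr dD xJ) !andbF.
have le2 : (#|I :&: J :|: I :&: D| <= #|I|)%N.
  by apply: subset_leq_card; rewrite subUset !subsetIl.
move: le1 le2; rewrite !cardsU dJD dIJD cards0 !subn0.
have := cardsID I J; have := cardsID I D; rewrite ![_ :&: I]setIC.
by move: ltIJ; clear; lia.
Qed.

Definition dual : matroid T := Matroid dual_sub dual0 dualS dual_aug.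

Variable D : {set T}.

Definition delete_indep : {set {set T}} :=
  [set I in indep M | I \subset ground M :\: D].

Fact delete_sub I : I \in delete_indep -> I \subset ground M :\: D.
Proof. by rewrite inE => /andP[]. Qed.

Fact delete0 : set0 \in delete_indep.
Proof. by rewrite inE indep0 sub0set. Qed.

Fact deleteS (I J : {set T}) : I \subset J -> J \in delete_indep -> I \in delete_indep.
Proof.
move=> sIJ; rewrite !inE => /andP[iJ sJ].
by rewrite (indepS sIJ iJ) (subset_trans sIJ sJ).
Qed.

Fact delete_aug (I J : {set T}) : I \in delete_indep -> J \in delete_indep ->
  (#|I| < #|J|)%N -> exists2 x, x \in J :\: I & x |: I \in delete_indep.
Proof.
rewrite !inE => /andP[iI sI] /andP[iJ sJ] ltIJ.
have [x xJI ix] := indep_aug iI iJ ltIJ; exists x => //.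
by rewrite inE ix subUset sI sub1set (subsetP sJ) //; case/setDP: xJI.
Qed.

Definition delete : matroid T :=
  Matroid delete_sub delete0 deleteS delete_aug.

End Matroid.

Definition contract (T : finType) (M : matroid T) (C : {set T}) : matroid T :=
  dual (delete (dual M) C).

Definition proper_minor (T : finType) (N M : matroid T) : Prop :=
  exists C D : {set T},
    [/\ C \subset ground M, D \subset ground M, [disjoint C & D],
        C :|: D != set0 & N = delete (contract M C) D].

(* The bijection is between the ground sets as subtypes: with a function      *)
(* T -> U instead, empty matroids would fail to be isomorphic when only U is  *)
(* empty.                                                                     *)
Definition isomorphic (T U : finType) (M : matroid T) (N : matroid U) : Prop :=
  exists2 f : {x : T | x \in ground M} -> {y : U | y \in ground N},
    bijective f &
    forall I : {set {x : T | x \in ground M}},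
      ([set val (f x) | x in I] \in indep N) =
      ([set val x | x in I] \in indep M).

Section ColumnMatroid.
Variables (F : fieldType) (r n : nat) (A : 'M[F]_(r, n)).

Definition column_indep : {set {set 'I_n}} :=
  [set I : {set 'I_n} | free [seq col i A | i <- enum I]].

Fact column_sub I : I \in column_indep -> I \subset [set: 'I_n].
Proof. by rewrite subsetT. Qed.

Fact column0 : set0 \in column_indep.
Proof. by rewrite inE enum_set0 /= nil_free. Qed.

Lemma column_indepU1 x (I : {set 'I_n}) : x \notin I ->
  (x |: I \in column_indep) =
  (col x A \notin <<[seq col i A | i <- enum I]>>%VS) && (I \in column_indep).
Proof.
move=> xI; rewrite !inE -free_cons; apply: perm_free.
rewrite -[_ :: _]/([seq col i A | i <- x :: enum I]).
apply/perm_map/uniq_perm; rewrite /= ?enum_uniq ?mem_enum ?xI // => y.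
by rewrite inE !mem_enum in_setU1.
Qed.

Fact columnS (I J : {set 'I_n}) :
  I \subset J -> J \in column_indep -> I \in column_indep.
Proof.
move=> sIJ; rewrite !inE.
suff /perm_free-> : perm_eq [seq col i A | i <- enum J]
  ([seq col i A | i <- enum I] ++ [seq col i A | i <- enum (J :\: I)]).
  exact: catl_free.
rewrite -map_cat; apply/perm_map/uniq_perm; rewrite ?enum_uniq //.
  rewrite cat_uniq !enum_uniq andbT /=; apply/hasPn=> y.
  by rewrite !mem_enum => /setDP[].
move=> y; rewrite mem_cat !mem_enum inE.
by case: (boolP (y \in I)) => //= /(subsetP sIJ).
Qed.

Fact column_aug (I J : {set 'I_n}) :
  I \in column_indep -> J \in column_indep -> (#|I| < #|J|)%N ->
  exists2 x, x \in J :\: I & x |: I \in column_indep.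
Proof.
move=> iI iJ ltIJ; apply/exists_inP; apply: contraLR ltIJ.
move=> /exists_inPn noaug; rewrite -leqNgt.
have sJI : (<<[seq col i A | i <- enum J]>> <=
            <<[seq col i A | i <- enum I]>>)%VS.
  apply/span_subvP=> _ /mapP[x + ->]; rewrite mem_enum => xJ.
  have [xI|xI] := boolP (x \in I).
    by apply/memv_span/map_f; rewrite mem_enum.
  have := noaug x; rewrite inE xI xJ => /(_ isT).
  by rewrite column_indepU1 // iI andbT negbK.
move: iI iJ (dimvS sJI); rewrite !inE /free => /eqP-> /eqP->.
by rewrite !size_map -!cardE.
Qed.

Definition column_matroid : matroid 'I_n :=
  Matroid column_sub column0 columnS column_aug.

End ColumnMatroid.

Definition representable (F : fieldType) (T : finType) (M : matroid T) : Prop :=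
  exists (r n : nat) (A : 'M[F]_(r, n)), isomorphic M (column_matroid A).

Definition has_char (F : fieldType) (k : nat) : Prop :=
  if k == 0%N then [pchar F] =i pred0 else k \in [pchar F].

Definition char_set (T : finType) (M : matroid T) (k : nat) : Prop :=
  exists2 F : fieldType, has_char F k & representable F M.

Definition matroid_class := forall T : finType, matroid T -> Prop.

Definition excluded_minor (P : matroid_class) (T : finType) (M : matroid T) :
  Prop := ~ P T M /\ forall N : matroid T, proper_minor N M -> P T N.

(* The F-representable matroids that are representable over some field of     *)
(* every characteristic; AC_4 is the case F = GF(4).                          *)
Definition all_char (F : fieldType) : matroid_class := fun T M =>
  representable F M /\ forall k : nat, prime k \/ k = 0%N -> char_set M k.

Definition mx_of_rows (F : fieldType) (r n : nat) (s : seq (seq F)) :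
  'M[F]_(r, n) := \matrix_(i, j) (nth [::] s i)`_j.

Section Matroids.
Variables (F : fieldType) (a : F).

Definition V1 : matroid 'I_9 := column_matroid (mx_of_rows 3 9
  [:: [:: 1; 0; 0; 1; 0; 1;      1;      1; 1];
      [:: 0; 1; 0; 1; 1; a ^+ 2; a ^+ 2; a; 0];
      [:: 0; 0; 1; 0; 1; 1;      a;      1; a]]).

Definition V2 : matroid 'I_8 := column_matroid (mx_of_rows 4 8
  [:: [:: 1; 0; 0; 0; 1;      1;      1; 0];
      [:: 0; 1; 0; 0; a ^+ 2; a;      a; 1];
      [:: 0; 0; 1; 0; a;      a ^+ 2; a; 1];
      [:: 0; 0; 0; 1; a ^+ 2; a ^+ 2; a; a]]).

Definition V3 : matroid 'I_9 := column_matroid (mx_of_rows 4 9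
  [:: [:: 1; 0; 0; 0; 1; 0; 1;      1;      1];
      [:: 0; 1; 0; 0; a; 1; a ^+ 2; a ^+ 2; 1];
      [:: 0; 0; 1; 0; a; 1; a;      1;      a ^+ 2];
      [:: 0; 0; 0; 1; 0; 1; 1;      0;      0]]).

Definition P1 : matroid 'I_9 := column_matroid (mx_of_rows 3 9
  [:: [:: 0; 1; 1; 1; 1; 1;      0; 0; 0];
      [:: 0; 1; a; 0; 0; 0;      1; 1; 1];
      [:: 1; 0; 0; 1; a; a ^+ 2; 1; a; a ^+ 2]]).

Definition P2 : matroid 'I_8 := column_matroid (mx_of_rows 4 8
  [:: [:: 1; 0; 0; 0; 1;      0; 1;      1];
      [:: 0; 1; 0; 0; a;      1; 1;      1];
      [:: 0; 0; 1; 0; 1;      1; 0;      1];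
      [:: 0; 0; 0; 1; a ^+ 2; 1; a ^+ 2; 0]]).

Definition P3 : matroid 'I_9 := column_matroid (mx_of_rows 3 9
  [:: [:: 0; 1; 1; 1;      1; 1; 1;      0; 0];
      [:: 0; 1; a; a ^+ 2; 0; 0; 0;      1; 1];
      [:: 1; 0; 0; 0;      1; a; a ^+ 2; 1; a]]).

End Matroids.

(* Main.v *)
From HB Require Import structures.
From Stdlib Require Import ZArith.
Require Import Defs.
From mathcomp Require Import all_boot all_order all_algebra all_field.
From mathcomp Require Import zify ssrZ ring.

(** The six matroids are handled through circuit-hyperplane relaxations (and,
    for P1, one tightening). If a matrix B has the same nonzero maximal minors
    as A except at a single set S of columns, then B represents M[A] \ e for
    every e in S and M[A] / e for every e outside S. For each of the six
    matroids finitely many such B, whose exceptional sets cover the ground set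
    and have empty intersection, therefore represent all the proper minors.

    For V1, V2 and V3 the matrices B have entries in Z[t] with t^2 = t + 1; all
    their relevant minors are 0 or units, so they work over any field containing
    a root of that polynomial, in every characteristic. P1, P2 and P3 are
    themselves representable over Z[w, 1/3] with w a primitive cube root of
    unity, hence in every characteristic other than 3, so that the matrices B
    are needed in characteristic 3 only, where they have entries in GF(9).

    Conversely, bringing an arbitrary representation to a normal form and
    solving the equations given by the vanishing minors shows 2 = 0 for the V_i
    and, for the P_i, an equation that degenerates when 3 = 0. *)

Set Implicit Arguments.
Unset Strict Implicit.
Unset Printing Implicit Defensive.

Import GRing.Theory.
Local Open Scope ring_scope.
Delimit Scope Z_scope with ZZ.

(** * Rank and minors *)

Section Rank.
Variables (T : finType) (M : matroid T).
Implicit Types I J X C D : {set T}.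

Definition rk X : nat := \max_(I in indep M | I \subset X) #|I|.

Lemma rk_ge I X : I \in indep M -> I \subset X -> (#|I| <= rk X)%N.
Proof.
by move=> iI sIX; rewrite /rk (bigD1 I) ?iI //= leq_maxl.
Qed.

Lemma rk_witness X : exists I, [/\ I \in indep M, I \subset X & #|I| = rk X].
Proof.
have P0 : (set0 \in indep M) && (set0 \subset X) by rewrite indep0 sub0set.
have [|I /andP[iI sI] e] :=
  @eq_bigmax_cond _ [pred I | (I \in indep M) && (I \subset X)]
    (fun I : {set T} => #|I|).
  by apply/card_gt0P; exists set0.
by exists I; split=> //; rewrite -e.
Qed.

Lemma rk_extend I X : I \in indep M -> I \subset X ->
  exists K, [/\ K \in indep M, I \subset K, K \subset X & #|K| = rk X].
Proof.
move=> iI sIX; have [J [iJ sJX cJ]] := rk_witness X.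
have [|K [iK sIK sK cK]] := indep_extend iI iJ; first by rewrite cJ rk_ge.
exists K; split=> //; last by rewrite cK.
by rewrite (subset_trans sK) // subUset sIX.
Qed.

Lemma rkU_le I C : (rk (I :|: C) <= #|I| + rk C)%N.
Proof.
have [J [iJ sJ <-]] := rk_witness (I :|: C).
rewrite -(cardsID C J) addnC leq_add //.
  apply: subset_leq_card; apply/subsetP => x /setDP[/(subsetP sJ)].
  by rewrite inE => /orP[|->].
by apply: rk_ge; [apply: indepS iJ|]; rewrite ?subsetIl ?subsetIr.
Qed.

Lemma card_basis_rk B : B \in bases M -> #|B| = rk (ground M).
Proof.
move=> bB; have iB := bases_indep bB.
apply/eqP; rewrite eqn_leq rk_ge ?indep_sub //=.
by have [J [iJ _ <-]] := rk_witness (ground M); apply: indep_le_basis bB.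
Qed.

Lemma basis_extend I : I \in indep M -> exists2 B, B \in bases M & I \subset B.
Proof.
move=> iI; have [B mB sIB] := @maxset_exists _ (mem (indep M)) I iI.
by exists B; rewrite ?inE.
Qed.

(* A basis of the deletion of C in the dual is the complement, in the         *)
(* remaining elements, of a basis of M that meets C in as many elements as    *)
(* possible.                                                                  *)
Lemma contract_indepE C I : C \subset ground M ->
  (I \in indep (contract M C)) =
  (I \subset ground M :\: C) && (rk (I :|: C) == #|I| + rk C)%N.
Proof.
move=> sC; rewrite inE /=.
have [sI /=|//] := boolP (I \subset ground M :\: C).
have disIC : [disjoint I & C].
  apply/pred0P => x /=; apply/negP => /andP[/(subsetP sI)].
  by rewrite inE => /andP[/negbTE->].
have memN (J : {set T}) : J \in indep (delete (dual M) C) =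
    (J \subset ground M :\: C) && [exists B in bases M, [disjoint J & B]].
  rewrite inE /= inE andbC; case: (boolP (J \subset ground M :\: C)) => //= s.
  by rewrite (subset_trans s (subsetDl _ _)).
apply/existsP/eqP => [[J /andP[]]|rkE].
  rewrite inE => /maxsetP[]; rewrite [mem _ J]memN => /andP[sJ].
  case/existsP => B /andP[bB dJB] maxJ dIJ.
  have {maxJ} maxJ (B' : {set T}) : B' \in bases M ->
      J \subset ground M :\: C :\: B' -> ground M :\: C :\: B' = J.
    move=> bB'; apply: maxJ; rewrite [mem _ _]memN subsetDl.
    apply/existsP; exists B'; rewrite bB' /=.
    by rewrite disjoint_sym -setI_eq0 setDE setICA setICr setI0.
  have EJ : ground M :\: C :\: B = J.
    apply: maxJ => //; apply/subsetP => x xJ.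
    by rewrite inE (subsetP sJ) // (disjointFr dJB xJ).
  have sIB : I \subset B.
    apply/subsetP => x xI; apply: contraFT (disjointFr dIJ xI) => xB.
    by rewrite -EJ inE xB (subsetP sI).
  have iBC : B :&: C \in indep M := indepS (subsetIl _ _) (bases_indep bB).
  (* Otherwise some [x] in [C] could be added to [B :&: C] and the result completed from [B] to a
     basis [B']. Outside [C] this [B'] lies in [B], so maximality of [J] gives [B' :\: C = B :\: C],
     although [B'] has the cardinality of [B] and more elements in [C]. *)
  have cBC : #|B :&: C| = rk C.
    apply/eqP; rewrite eqn_leq rk_ge ?subsetIr //= leqNgt; apply/negP => lt.
    have [K [iK sK cK]] := rk_witness C; rewrite -cK in lt.
    have [x /setDP[xK xB] ix] := indep_aug iBC iK lt.
    have xC := subsetP sK _ xK.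
    have {}xB : x \notin B by move: xB; rewrite inE xC andbT.
    have [|B' [iB' sB' B'S cB']] := indep_extend ix (bases_indep bB).
      exact: indep_le_basis ix bB.
    have bB' := card_basis bB iB' cB'.
    have E' : ground M :\: C :\: B' = J.
      apply: maxJ => //; rewrite -EJ; apply/subsetP => y.
      rewrite !inE => /and3P[yB yC ->]; rewrite yC !andbT.
      apply: contra yB => /(subsetP B'S); rewrite !inE (negbTE yC) andbF orbF.
      by case/orP => // /eqP yx; rewrite yx xC in yC.
    have E2 : B' :\: C = B :\: C.
      apply/setP => y; rewrite !inE.
      have [//|yC] /= := boolP (y \in C).
      have /setP/(_ y) := etrans E' (esym EJ); rewrite !inE yC /=.
      case: (boolP (y \in ground M)) => [_|yG _]; last first.
        by rewrite !(contraNF (subsetP (indep_sub _) y) yG) ?bases_indep.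
      by rewrite !andbT => /negb_inj.
    have := cardsID C B; have := cardsID C B'; rewrite E2 cB'.
    suff : (#|B :&: C| < #|B' :&: C|)%N by clear; lia.
    rewrite (@leq_trans #|x |: B :&: C|) //.
      by rewrite cardsU1 inE (negbTE xB).
    apply: subset_leq_card; rewrite subsetI sB' subUset sub1set xC.
    exact: subsetIr.
  apply/eqP; rewrite eqn_leq rkU_le /= -cBC.
  have <- : #|I :|: B :&: C| = (#|I| + #|B :&: C|)%N.
    rewrite cardsU (_ : I :&: _ = set0) ?cards0 ?subn0 //.
    by apply/eqP; rewrite setI_eq0 (disjointWr (subsetIr B C)).
  apply: rk_ge; last by rewrite setUS // subsetIr.
  by apply: indepS (bases_indep bB); rewrite subUset sIB subsetIl.
(* Conversely, a maximal independent subset [X] of [I :|: C] is completed to a basis [B]. As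
   [#|X| = #|I| + rk C], counting inside and outside [C] forces [I \subset B] and
   [#|B :&: C| = rk C]. *)
have [X [iX sX cX]] := rk_witness (I :|: C).
have [B bB sXB] := basis_extend iX.
have sBG := indep_sub (bases_indep bB).
have leXC : (#|B :&: C| <= rk C)%N.
  by apply: rk_ge; rewrite ?subsetIr // (indepS (subsetIl _ _)) ?bases_indep.
have leX : (#|X :\: C| <= #|X :&: I|)%N.
  apply: subset_leq_card; apply/subsetP => x /setDP[xX xC].
  by move: (subsetP sX _ xX); rewrite !inE (negbTE xC) orbF xX.
have lXI : (#|X :&: I| <= #|I|)%N by rewrite subset_leq_card ?subsetIr.
have lXC : (#|X :&: C| <= #|B :&: C|)%N by rewrite subset_leq_card ?setSI.
have cXC := cardsID C X.
have sIB : I \subset B.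
  have /setIidPr <- : I \subset X; last exact: subset_trans (subsetIl _ _) sXB.
  apply/setIidPr/eqP; rewrite eqEcard subsetIr /=.
  by move: leXC leX lXC cXC cX; rewrite rkE; clear; lia.
have cBC : #|B :&: C| = rk C.
  by move: leXC leX lXI lXC cXC cX; rewrite rkE; clear; lia.
exists (ground M :\: C :\: B); rewrite inE; apply/andP; split; last first.
  rewrite -setI_eq0; apply/eqP/setP => x; rewrite !inE.
  by case: (boolP (x \in I)) => //= /(subsetP sIB)->.
apply/maxsetP; split.
  rewrite [mem _ _]memN subsetDl; apply/existsP; exists B; rewrite bB /=.
  by rewrite disjoint_sym -setI_eq0 setDE setICA setICr setI0.
move=> J; rewrite [mem _ J]memN => /andP[sJ /existsP[B' /andP[bB' dJ]]] sBJ.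
(* The set [J] avoids the basis [B'], which has at most [rk C] elements in [C] and hence at least as
   many outside [C] as [B]. So [J] is no larger than the complement of [B]. *)
apply/eqP; rewrite eq_sym eqEcard sBJ /=.
have sBG' := indep_sub (bases_indep bB').
have eB : #|B| = #|B'| by rewrite !card_basis_rk.
have le1 : (#|B' :&: C| <= rk C)%N.
  by apply: rk_ge; rewrite ?subsetIr // (indepS (subsetIl _ _)) ?bases_indep.
have le2 : (#|J| + #|B' :\: C| <= #|ground M :\: C|)%N.
  have := leq_card_setU J (B' :\: C); have dd : J :&: (B' :\: C) = set0.
    by apply/eqP; rewrite setI_eq0 (disjointWr (subsetDl B' C)).
  have -> : (#|J| + #|B' :\: C| = #|J :|: (B' :\: C)|)%N.
    by rewrite cardsU dd cards0 subn0.
  by move=> _; apply: subset_leq_card; rewrite subUset sJ setSD.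
have := cardsID C B; have := cardsID C B'.
have := cardsID B (ground M :\: C).
have -> : (ground M :\: C) :&: B = B :\: C.
  by rewrite setIC setIDA (setIidPl sBG).
by move: eB le1 le2 cBC; clear; lia.
Qed.

Lemma minor_indepE C D I : C \subset ground M ->
  (I \in indep (delete (contract M C) D)) =
  (I \subset ground M :\: C :\: D) && (rk (I :|: C) == #|I| + rk C)%N.
Proof.
move=> sC; rewrite inE /= contract_indepE // andbC.
have [s|//] := boolP (I \subset _ :\: D).
by rewrite (subset_trans s (subsetDl _ _)).
Qed.

End Rank.

(** * Representations *)

Lemma perm_free_map (F : fieldType) (vT : vectType F) (T : eqType)
    (v : T -> vT) (s t : seq T) :
  perm_eq s t -> free [seq v i | i <- s] = free [seq v i | i <- t].
Proof. by move=> st; apply/perm_free/perm_map. Qed.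

Lemma free_map_seq (F : fieldType) (vT : vectType F) (T : finType)
    (v : T -> vT) (S : {set T}) (s : seq T) : uniq s -> S =i s ->
  free [seq v i | i <- enum S] = free [seq v i | i <- s].
Proof.
move=> us eqs; apply/perm_free_map/uniq_perm; rewrite ?enum_uniq // => x.
by rewrite mem_enum.
Qed.

Section Representations.
Variable F : fieldType.

(** One vector per element of [T] is easier to supply than a matrix with a bijection; the matrix
    lists the vectors of the ground set in the order of [enum_val]. *)
Lemma representable_intro (T : finType) (M : matroid T) (r : nat)
    (v : T -> 'cV[F]_r) :
  (forall I : {set T}, I \subset ground M ->
    (I \in indep M) = free [seq v i | i <- enum I]) ->
  representable F M.
Proof.
move=> vP; pose G := ground M.
pose A : 'M[F]_(r, #|G|) := \matrix_(i, j) v (enum_val j) i 0.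
have colA j : col j A = v (enum_val j).
  by apply/matrixP => i k; rewrite !mxE ord1.
exists r, #|G|, A.
pose f (x : {x : T | x \in G}) : {y : 'I_#|G| | y \in ground (column_matroid A)} :=
  exist _ (enum_rank_in (valP x) (val x)) (in_setT _).
pose g (y : {y : 'I_#|G| | y \in ground (column_matroid A)}) : {x : T | x \in G} :=
  exist _ (enum_val (val y)) (enum_valP (val y)).
have fK : cancel f g by move=> x; apply: val_inj; rewrite /= enum_rankK_in ?(valP x).
have gK : cancel g f by move=> y; apply: val_inj; rewrite /= enum_valK_in.
exists f; first by exists g.
move=> I; rewrite vP; last by apply/subsetP => _ /imsetP[x _ ->]; apply: (valP x).
rewrite inE.
rewrite (@free_map_seq _ _ _ _ _ [seq val (f x) | x <- enum I]); first last.
- by move=> y; apply/imsetP/mapP => -[x xI ->]; exists x;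
    rewrite // ?mem_enum // -mem_enum.
- by rewrite map_inj_uniq ?enum_uniq // => x y /val_inj; apply: (can_inj fK).
rewrite [in RHS](@free_map_seq _ _ _ _ _ [seq val x | x <- enum I]); first last.
- by move=> y; apply/imsetP/mapP => -[x xI ->]; exists x;
    rewrite // ?mem_enum // -mem_enum.
- by rewrite map_inj_uniq ?enum_uniq //; apply: val_inj.
rewrite -!map_comp; congr (free _); apply: eq_map => x /=.
by rewrite colA enum_rankK_in ?(valP x).
Qed.

Lemma representable_elim (T : finType) (M : matroid T) :
  representable F M -> exists (r : nat) (v : T -> 'cV[F]_r),
  forall I : {set T}, I \subset ground M ->
    (I \in indep M) = free [seq v i | i <- enum I].
Proof.
move=> [r [n [A [f [g fK gK] fP]]]].
(* The value 0 outside the ground set is a default: only subsets of the ground set are tested. *)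
pose w (x : T) : 'cV[F]_r :=
  if insub x is Some y then col (val (f y)) A else 0.
exists r, w => I sI.
pose J : {set {x : T | x \in ground M}} := [set x | val x \in I].
have IJ : I = [set val x | x in J].
  apply/setP => x; apply/idP/imsetP => [xI|[y + ->]]; last by rewrite inE.
  by exists (Sub x (subsetP sI _ xI)); rewrite ?inE SubK.
rewrite {1}IJ -fP inE.
rewrite (@free_map_seq _ _ _ _ _ [seq val (f x) | x <- enum J]); first last.
- by move=> y; apply/imsetP/mapP => -[x xI ->]; exists x;
    rewrite // ?mem_enum // -mem_enum.
- by rewrite map_inj_uniq ?enum_uniq // => x y /val_inj; apply: (can_inj fK).
rewrite [in RHS](@free_map_seq _ _ _ _ _ [seq val x | x <- enum J]); first last.
- rewrite IJ => y.
  by apply/imsetP/mapP => -[x xI ->]; exists x;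
    rewrite // ?mem_enum // -mem_enum.
- by rewrite map_inj_uniq ?enum_uniq //; apply: val_inj.
rewrite -!map_comp; congr (free _); apply: eq_map => x /=.
by rewrite /w valK.
Qed.

Lemma representable_eq (T : finType) (M N : matroid T) :
  ground M = ground N -> indep M = indep N ->
  representable F M -> representable F N.
Proof.
move=> eG eI /representable_elim[r [v vP]].
by apply: (@representable_intro _ _ r v) => I; rewrite -eG -eI; apply: vP.
Qed.

Lemma representable_column (r n : nat) (A : 'M[F]_(r, n)) :
  representable F (column_matroid A).
Proof.
apply: (@representable_intro _ (column_matroid A) r (fun i => col i A)) => I _.
by rewrite inE.
Qed.

(** * Ranks and minors of column matroids *)

Section Columns.
Variables (r n : nat) (A : 'M[F]_(r, n)).
Implicit Types X Y : {set 'I_n}.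

Definition colspan (X : {set 'I_n}) : {vspace 'cV[F]_r} :=
  <<[seq col i A | i <- enum X]>>%VS.

Lemma mem_colspan X i : i \in X -> col i A \in colspan X.
Proof. by move=> iX; apply/memv_span/map_f; rewrite mem_enum. Qed.

Lemma colspan_le X (U : {vspace 'cV[F]_r}) :
  (forall i, i \in X -> col i A \in U) -> (colspan X <= U)%VS.
Proof.
move=> XU; apply/span_subvP => _ /mapP[i + ->]; rewrite mem_enum; exact: XU.
Qed.

Lemma colspanU X Y : colspan (X :|: Y) = (colspan X + colspan Y)%VS.
Proof.
apply/eqP; rewrite eqEsubv; apply/andP; split.
  apply: colspan_le => i; rewrite inE => /orP[] /mem_colspan.
    by apply/subvP; rewrite addvSl.
  by apply/subvP; rewrite addvSr.
by rewrite subv_add; apply/andP; split; apply: colspan_le => i iX;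
  apply: mem_colspan; rewrite inE iX ?orbT.
Qed.

Lemma rk_column X : rk (column_matroid A) X = \dim (colspan X).
Proof.
have iE (I : {set 'I_n}) : I \in indep (column_matroid A) ->
    \dim (colspan I) = #|I|.
  by rewrite inE /free => /eqP->; rewrite size_map -cardE.
apply/eqP; rewrite eqn_leq; apply/andP; split.
  have [I [/iE <- sIX <-]] := rk_witness (column_matroid A) X.
  by apply/dimvS/colspan_le => i iI; apply/mem_colspan/(subsetP sIX).
have [I [iI sIX cI]] := rk_witness (column_matroid A) X.
rewrite -cI -(iE _ iI); apply/dimvS/colspan_le => x xX.
have [xI|xI] := boolP (x \in I); first exact: mem_colspan.
apply: contraT => nx.
(* Otherwise [x |: I] is an independent subset of [X] with more than [rk X] elements. *)
have ixI : x |: I \in indep (column_matroid A).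
  by rewrite column_indepU1 // iI andbT.
have := rk_ge ixI (X := X); rewrite cardsU1 xI subUset sub1set xX => /(_ sIX).
by rewrite -cI add1n ltnn.
Qed.

(* Contracting C amounts to projecting along the span of its columns.         *)
Lemma minor_representable (C D : {set 'I_n}) :
  representable F (delete (contract (column_matroid A) C) D).
Proof.
pose V := colspan C; pose f : 'End('cV[F]_r) := (\1 - projv V)%VF.
have fE u : f u = u - projv V u by rewrite add_lfunE opp_lfunE id_lfunE.
have kerf : lker f = V.
  apply/vspaceP => u; rewrite memv_ker fE subr_eq0; apply/eqP/idP => [->|uV].
    exact: memv_proj.
  by rewrite projv_id.
apply: (@representable_intro _ _ r (fun i : 'I_n => f (col i A))) => I sI.
rewrite minor_indepE ?subsetT // sI /= !rk_column.
rewrite (map_comp f (fun i : 'I_n => col i A)) /free -limg_span size_map size_map -cardE.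
(* Rank-nullity on the span of [I :|: C], which contains the kernel [V]: the images of the columns
   in [I] span a space of dimension [rk (I :|: C) - rk C]. *)
have := limg_ker_dim f (colspan (I :|: C)).
rewrite kerf colspanU limgD (_ : (f @: colspan C)%VS = 0%VS); last first.
  by apply/eqP; rewrite -lkerE kerf subvv.
rewrite addv0 (capv_idPr (addvSr _ _)) -/V -/(colspan I) => <-.
by rewrite addnC eqn_add2r.
Qed.

End Columns.
End Representations.

Lemma column_indep_dim (F : fieldType) (r n : nat) (A : 'M[F]_(r, n))
    (I : {set 'I_n}) : I \in column_indep A -> \dim (colspan A I) = #|I|.
Proof. by rewrite inE /free => /eqP->; rewrite size_map -cardE. Qed.

Lemma column_indep_le (F : fieldType) (r n : nat) (A : 'M[F]_(r, n))
    (I : {set 'I_n}) : I \in column_indep A -> (#|I| <= r)%N.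
Proof.
move=> /column_indep_dim <-.
by rewrite (leq_trans (dimvS (subvf _))) // dimvf /dim /= muln1.
Qed.

(** Only sets of size [r] are compared: as soon as one of them is independent, the independent ones
    are the bases. [P] restricts the comparison, for instance to the sets that contain, or avoid, a
    given element. *)
Definition agree_on (F G : fieldType) (r n : nat) (A : 'M[F]_(r, n))
    (B : 'M[G]_(r, n)) (P : pred {set 'I_n}) :=
  forall S : {set 'I_n}, #|S| = r -> P S ->
    (S \in column_indep A) = (S \in column_indep B).

(** A maximal independent subset of [X] is completed from [S0] to an independent set of size [r]
    that contains [e] exactly when [b] holds; the two matrices agree on that set. *)
Lemma agree_rk_le (F G : fieldType) (r n : nat) (A : 'M[F]_(r, n))
    (B : 'M[G]_(r, n)) (e : 'I_n) (b : bool) (S0 X : {set 'I_n}) :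
  agree_on A B (fun S => (e \in S) == b) ->
  #|S0| = r -> (e \in S0) = b -> S0 \in column_indep A -> (e \in X) = b ->
  (rk (column_matroid A) X <= rk (column_matroid B) X)%N.
Proof.
move=> AB cS0 eS0 iS0 eX.
(* When [b] holds, [e] is not a loop, since it lies in [S0], so [I] can be grown from [[set e]]. *)
have [I [iI sIX cI eI]] : exists I : {set 'I_n},
    [/\ I \in indep (column_matroid A), I \subset X,
        #|I| = rk (column_matroid A) X & b -> e \in I].
  case: b => [|] in eS0 eX {AB} *.
    have i1 : [set e] \in indep (column_matroid A).
      by apply: columnS iS0; rewrite sub1set eS0.
    have [|I [iI sI IX cI]] := rk_extend i1 (X := X); first by rewrite sub1set eX.
    by exists I; split=> // _; apply: (subsetP sI); rewrite set11.
  by have [I [iI sIX cI]] := rk_witness (column_matroid A) X; exists I; split.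
have [|K [iK sIK KS cK]] := @indep_extend _ (column_matroid A) I S0 iI iS0.
  by rewrite cS0 (column_indep_le iI).
have eK : (e \in K) = b.
  apply/idP/idP => [/(subsetP KS)|/eI /(subsetP sIK)//].
  by rewrite inE eS0 => /orP[/(subsetP sIX)|//]; rewrite eX.
rewrite -cI; apply: rk_ge => //=; apply: (columnS sIK).
by rewrite -AB ?cK ?eK ?eqxx.
Qed.

Lemma agree_rk (F G : fieldType) (r n : nat) (A : 'M[F]_(r, n))
    (B : 'M[G]_(r, n)) (e : 'I_n) (b : bool) (S0 X : {set 'I_n}) :
  agree_on A B (fun S => (e \in S) == b) ->
  #|S0| = r -> (e \in S0) = b -> S0 \in column_indep A -> (e \in X) = b ->
  rk (column_matroid A) X = rk (column_matroid B) X.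
Proof.
move=> AB cS0 eS0 iS0 eX; apply/eqP; rewrite eqn_leq.
rewrite (agree_rk_le AB cS0 eS0 iS0 eX) /=.
apply: (@agree_rk_le _ _ _ _ B A e b S0) => //.
  by move=> S cS eS; rewrite AB.
by rewrite -AB // eS0.
Qed.

(* Contraction of e only sees the bases that contain e, and deletion of e     *)
(* those that avoid e.                                                        *)
Lemma agree_minor_representable (F G : fieldType) (r n : nat)
    (A : 'M[F]_(r, n)) (B : 'M[G]_(r, n)) (e : 'I_n) (b : bool)
    (S0 C D : {set 'I_n}) :
  agree_on A B (fun S => (e \in S) == b) ->
  #|S0| = r -> (e \in S0) = b -> S0 \in column_indep A ->
  [disjoint C & D] -> e \in (if b then C else D) ->
  representable G (delete (contract (column_matroid A) C) D).
Proof.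
move=> AB cS0 eS0 iS0 dCD eCD.
have eqrk (I : {set 'I_n}) : I \subset [set: 'I_n] :\: C :\: D ->
    rk (column_matroid A) (I :|: C) = rk (column_matroid B) (I :|: C) /\
    rk (column_matroid A) C = rk (column_matroid B) C.
  move=> sI; have eC : (e \in C) = b.
    by case: b eCD {AB eS0} => // eD; rewrite (disjointFl dCD eD).
  have eIC : (e \in I :|: C) = b.
    rewrite inE eC; case: b eCD {AB eS0 eC} => [|eD]; rewrite ?orbT ?orbF //.
    by apply/negP => /(subsetP sI); rewrite !inE eD.
  by split; apply: (agree_rk AB cS0 eS0 iS0).
apply: (@representable_eq _ _ (delete (contract (column_matroid B) C) D));
  [by [] | | exact: minor_representable].
apply/setP => I.
have sC (H : fieldType) (E : 'M[H]_(r, n)) : C \subset ground (column_matroid E).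
  exact: subsetT.
apply: etrans (minor_indepE D I (sC _ B)) _.
apply: etrans _ (esym (minor_indepE D I (sC _ A))).
by have [/eqrk[-> ->]|//] := boolP (I \subset _).
Qed.

(** * Maximal minors over quadratic rings *)

Section FreeDet.
Variable F : fieldType.

Lemma row_freeV0P (k m : nat) (A : 'M[F]_(k, m)) :
  reflect (forall u : 'rV_k, u *m A = 0 -> u = 0) (row_free A).
Proof.
rewrite -kermx_eq0; apply: (iffP rowV0P) => H u.
  by move=> uA; apply: H; apply/sub_kermxP.
by move=> /sub_kermxP; apply: H.
Qed.

Lemma free_row_free (k m : nat) (w : 'I_k -> 'cV[F]_m) :
  free [seq w i | i <- enum 'I_k] = row_free (\matrix_(j, i) w j i 0).
Proof.
have sumE (u : 'I_k -> F) :
    ((\row_j u j) *m \matrix_(j, i) w j i 0)^T = \sum_(i < k) u i *: w i.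
  apply/matrixP => i j; rewrite !mxE summxE; apply: eq_bigr => l _.
  by rewrite !mxE ord1.
have nthE (u : 'I_k -> F) :
    \sum_(i < k) u i *: [seq w i | i <- enum 'I_k]`_i = \sum_(i < k) u i *: w i.
  apply: eq_bigr => i _; rewrite (nth_map i) ?size_enum_ord //.
  by rewrite nth_ord_enum.
apply/(@freeP _ _ _ [tuple of [seq w i | i <- ord_tuple k]])/row_freeV0P.
  move=> H u u0; apply/rowP => j; rewrite mxE; apply: (H (u 0)).
  rewrite nthE -sumE [_ *m _](_ : _ = 0) ?trmx0 // -[RHS]u0.
  by congr (_ *m _); apply/rowP => i; rewrite mxE.
move=> H u; rewrite nthE -sumE => /(congr1 trmx); rewrite trmxK trmx0 => /H.
by move=> /rowP u0 j; have := u0 j; rewrite !mxE.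
Qed.

Lemma column_indep_det (r n : nat) (A : 'M[F]_(r, n)) (g : 'I_r -> 'I_n)
    (S : {set 'I_n}) : injective g -> S =i codom g ->
  (S \in column_indep A) = (\det (\matrix_(i, j) A i (g j)) != 0).
Proof.
move=> g_inj Sg; rewrite inE (@free_map_seq _ _ _ _ _ (codom g)) //; last first.
  by rewrite map_inj_uniq ?enum_uniq.
rewrite codomE -map_comp free_row_free row_free_unit unitmxE unitfE -det_tr.
by congr (\det _ != 0); apply/matrixP => i j; rewrite !mxE.
Qed.

End FreeDet.

(** * Laplace expansion and enumeration of column sets *)

Section Laplace.
Variables (T : Type) (zero one : T) (add mul : T -> T -> T) (opp : T -> T).

(** Expansion along the first row over bare operations, so that one formula computes on pairs of
    integers and, through [gdet_morph], denotes a determinant in a ring. [bump j] skips column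
    [j]. *)
Fixpoint gdet (n : nat) (M : nat -> nat -> T) : T :=
  if n is m.+1 then
    foldr (fun j => add (mul (if odd j then opp (M 0%N j) else M 0%N j)
                             (gdet m (fun i k => M i.+1 (bump j k)))))
          zero (iota 0 n)
  else one.

Lemma gdet_morph (R : comNzRingType) (phi : T -> R) :
  phi zero = 0 -> phi one = 1 -> {morph phi : x y / add x y >-> x + y} ->
  {morph phi : x y / mul x y >-> x * y} -> {morph phi : x / opp x >-> - x} ->
  forall n (M : nat -> nat -> T),
    phi (gdet n M) = \det (\matrix_(i < n, j < n) phi (M i j)).
Proof.
move=> p0 p1 pD pM pN; elim=> [|n IHn] M; first by rewrite det_mx00.
rewrite (expand_det_row _ ord0) [gdet _ _]/(foldr _ _ _).
transitivity (\sum_(j <- iota 0 n.+1) phi (M 0%N j) *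
  ((-1) ^+ j * phi (gdet n (fun i k => M i.+1 (bump j k))))).
  elim: (iota 0 n.+1) => [|j s IHs] /=; first by rewrite big_nil.
  rewrite big_cons pD pM IHs; congr (_ + _).
  rewrite -signr_odd; case: (odd j); rewrite ?pN ?expr1 ?expr0 ?mul1r //.
  by rewrite mulN1r mulrN mulNr.
rewrite -/(index_iota 0 n.+1) big_mkord; apply: eq_bigr => j _.
rewrite mxE /cofactor IHn /= add0n; congr (_ * (_ * \det _)).
by apply/matrixP => i k; rewrite !mxE.
Qed.

End Laplace.

Fixpoint comb (r : nat) (s : seq nat) : seq (seq nat) :=
  match r, s with
  | 0, _ => [:: [::]]
  | _.+1, [::] => [::]
  | r'.+1, x :: s' => [seq x :: t | t <- comb r' s'] ++ comb r s'
  end.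

Lemma mem_comb (s t : seq nat) : subseq t s -> t \in comb (size t) s.
Proof.
elim: s t => [|x s IHs] [|y t] //=.
case: eqP => [->|_] st; rewrite mem_cat; last by rewrite (IHs _ st) orbT.
by rewrite map_f // IHs.
Qed.

Definition ord_list (n : nat) (S : {set 'I_n}) : seq nat :=
  [seq val i | i <- enum S].

Lemma mem_ord_list (n : nat) (S : {set 'I_n}) (i : 'I_n) :
  ((i : nat) \in ord_list S) = (i \in S).
Proof. by rewrite mem_map ?mem_enum //; apply: val_inj. Qed.

Lemma subseq_ord_list (n : nat) (S : {set 'I_n}) : subseq (ord_list S) (iota 0 n).
Proof.
by rewrite -val_enum_ord; apply: map_subseq; rewrite enumT; apply: filter_subseq.
Qed.

Lemma ord_list_comb (r n : nat) (S : {set 'I_n}) : #|S| = r ->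
  ord_list S \in comb r (iota 0 n).
Proof.
move=> cS; have := mem_comb (subseq_ord_list S).
by rewrite size_map -cardE cS.
Qed.

Definition set_of_list (n : nat) (s : seq nat) : {set 'I_n} :=
  [set i : 'I_n | (i : nat) \in s].

(** A subsequence of [iota 0 n] is strictly increasing, hence determined by its elements. *)
Lemma comb_ord_list (r n : nat) (s : seq nat) : s \in comb r (iota 0 n) ->
  ord_list (set_of_list n s) = s /\ #|set_of_list n s| = r.
Proof.
have combP (t : seq nat) : forall r, s \in comb r t -> subseq s t /\ size s = r.
  elim: t (s) => [|x t IHt] u [|k] //=.
  - by rewrite inE => /eqP->.
  - by rewrite inE => /eqP->.
  rewrite mem_cat => /orP[/mapP[w /IHt[sw <-] ->]|/IHt[sw <-]].
    by rewrite eqxx.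
  by split=> //; apply: subseq_trans sw (subseq_cons t x).
move=> /combP[ss cs].
have E : ord_list (set_of_list n s) = s.
  apply: (irr_sorted_eq ltn_trans ltnn).
  - exact: subseq_sorted ltn_trans _ _ (subseq_ord_list _) (iota_ltn_sorted _ _).
  - exact: subseq_sorted ltn_trans _ _ ss (iota_ltn_sorted _ _).
  move=> x; apply/mapP/idP => [[i]|xs].
    by rewrite mem_enum inE => + ->.
  have := mem_subseq ss xs; rewrite mem_iota add0n => xn.
  by exists (Ordinal xn); rewrite ?mem_enum ?inE.
by split=> //; rewrite cardE -(size_map val) -/(ord_list _) E.
Qed.

Lemma column_indep_ord_list (F : fieldType) (r n : nat) (A : 'M[F]_(r, n))
    (f : nat -> nat -> F) (S : {set 'I_n}) :
  (forall i j, A i j = f i j) -> #|S| = r ->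
  (S \in column_indep A) =
  (\det (\matrix_(i < r, k < r) f i (nth 0%N (ord_list S) k)) != 0).
Proof.
move=> Af cS; pose g (i : 'I_r) : 'I_n := enum_val (cast_ord (esym cS) i).
have g_inj : injective g by move=> i j /enum_val_inj/cast_ord_inj.
rewrite (@column_indep_det _ _ _ _ g) //; last first.
  move=> x; apply/idP/codomP => [xS|[i ->]]; last exact: enum_valP.
  exists (cast_ord cS (enum_rank_in xS x)).
  by rewrite /g cast_ordK enum_rankK_in.
congr (\det _ != 0); apply/matrixP => i j; rewrite !mxE Af; congr (f i _).
rewrite /ord_list (nth_map (g j)) -?cardE ?cS // /g.
by rewrite /enum_val /=; congr (val _); apply: set_nth_default; rewrite -cardE cS.
Qed.

(* A pair (a, b) stands for a + b t, where t ^ 2 = qu t + qv in a field in    *)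
(* which qc = 0 and qn <> 0.                                                  *)
Record qring := QRing { qu : Z; qv : Z; qc : Z; qn : Z }.

Definition qadd (x y : Z * Z) := ((x.1 + y.1)%ZZ, (x.2 + y.2)%ZZ).
Definition qopp (x : Z * Z) := ((- x.1)%ZZ, (- x.2)%ZZ).
Definition qmul (R : qring) (x y : Z * Z) :=
  ((x.1 * y.1 + qv R * (x.2 * y.2))%ZZ,
   (x.1 * y.2 + x.2 * y.1 + qu R * (x.2 * y.2))%ZZ).
(** The product of [a + b t] with its conjugate [a + b (u - t)], where [u = qu R]. *)
Definition qnorm (R : qring) (x : Z * Z) : Z :=
  (x.1 * x.1 + qu R * (x.1 * x.2) - qv R * (x.2 * x.2))%ZZ.

(* A norm that divides a power of qn modulo qc is nonzero; the exponent 8 is  *)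
(* large enough for all the matrices below.                                   *)
Definition qstat (R : qring) (x : Z * Z) : option bool :=
  if (Z.modulo x.1 (qc R) =? 0)%ZZ && (Z.modulo x.2 (qc R) =? 0)%ZZ then Some false
  else if (Z.modulo (qn R ^ 8) (Z.gcd (qnorm R x) (qc R)) =? 0)%ZZ then Some true
  else None.

Section QEval.
Variables (F : fieldType) (R : qring) (t : F).

Definition zeval (z : Z) : F := (int_of_Z z)%:~R.

Lemma zevalD (x y : Z) : zeval (x + y)%ZZ = zeval x + zeval y.
Proof. by rewrite /zeval -intrD -[in RHS]rmorphD. Qed.
Lemma zevalM (x y : Z) : zeval (x * y)%ZZ = zeval x * zeval y.
Proof. by rewrite /zeval -intrM -[in RHS]rmorphM. Qed.
Lemma zevalN (x : Z) : zeval (- x)%ZZ = - zeval x.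
Proof. by rewrite /zeval -[RHS]mulrNz -[in RHS]rmorphN. Qed.
Lemma zevalX (x : Z) (n : nat) : zeval (x ^ Z.of_nat n)%ZZ = zeval x ^+ n.
Proof.
elim: n => [|n IHn]; first by rewrite expr0.
by rewrite Nat2Z.inj_succ Z.pow_succ_r ?zevalM ?IHn ?exprS //; lia.
Qed.

Lemma zeval_dvd (x y : Z) :
  (Z.modulo x y =? 0)%ZZ -> exists q, zeval x = zeval q * zeval y.
Proof.
move=> /Z.eqb_spec xy; exists (Z.div x y); rewrite -zevalM; congr zeval.
have [y0|y0] := Z.eq_dec y 0%ZZ.
  (* By convention [Z.modulo x 0] is [x], so a zero modulus makes the test mean [x = 0]. *)
  by move: xy; rewrite y0 Zmod_0_r; lia.
by have := Z.div_mod x y y0; lia.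
Qed.

Definition qeval (x : Z * Z) : F := zeval x.1 + zeval x.2 * t.

Definition qmodel : Prop :=
  [/\ t ^+ 2 = zeval (qu R) * t + zeval (qv R), zeval (qc R) = 0
    & zeval (qn R) != 0].

Hypothesis tP : qmodel.

Lemma qevalD : {morph qeval : x y / qadd x y >-> x + y}.
Proof. by move=> x y; rewrite /qeval /= !zevalD; ring. Qed.

Lemma qevalN : {morph qeval : x / qopp x >-> - x}.
Proof. by move=> x; rewrite /qeval /= !zevalN; ring. Qed.

Lemma qevalM : {morph qeval : x y / qmul R x y >-> x * y}.
Proof.
move=> x y; case: tP => t2 _ _; rewrite /qeval /= !(zevalD, zevalM).
have -> : zeval (qv R) = t ^+ 2 - zeval (qu R) * t by rewrite t2 addrC addKr.
by ring.
Qed.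

(** If the value vanished, so would the norm. By Bezout the gcd of the norm and [qc] would then
    vanish in [F], and with it the power of [qn] that it divides. *)
Lemma qstatP x b : qstat R x = Some b -> (qeval x != 0) = b.
Proof.
case: tP => t2 c0 n0; rewrite /qstat; case: ifP => [/andP[]|_].
  case/zeval_dvd => p xp /zeval_dvd[q xq] [<-].
  by rewrite /qeval xp xq c0 !mulr0 mul0r addr0 eqxx.
case: ifP => // /zeval_dvd[q eq] [<-]; apply/eqP => x0.
have norm0 : zeval (qnorm R x) = 0.
  rewrite /qnorm /Z.sub !(zevalD, zevalM, zevalN).
  transitivity (qeval x * (zeval x.1 + zeval x.2 * (zeval (qu R) - t))); last first.
    by rewrite x0 mul0r.
  have -> : zeval (qv R) = t ^+ 2 - zeval (qu R) * t by rewrite t2 addrC addKr.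
  by rewrite /qeval; ring.
have [u [v uv]] := Z.gcd_bezout (qnorm R x) (qc R) _ erefl.
move: eq; rewrite -uv zevalD zevalM zevalM norm0 c0 !mulr0 addr0 mulr0.
by rewrite -[8%ZZ]/(Z.of_nat 8) zevalX => /eqP; rewrite expf_eq0 (negbTE n0).
Qed.

End QEval.

Definition qmx (F : fieldType) (t : F) (r n : nat) (d : seq (seq (Z * Z))) :
  'M[F]_(r, n) := \matrix_(i, j) qeval t (nth (0, 0)%ZZ (nth [::] d i) j).

Definition qminor (R : qring) (r : nat) (d : seq (seq (Z * Z))) (s : seq nat) :=
  gdet (0, 0)%ZZ (1, 0)%ZZ qadd (qmul R) qopp r
    (fun i k => nth (0, 0)%ZZ (nth [::] d i) (nth 0%N s k)).

Definition qbasis (R : qring) r d s := qstat R (qminor R r d s).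

Lemma qbasisP (F : fieldType) (R : qring) (t : F) (r n : nat) d
    (S : {set 'I_n}) b : qmodel R t -> #|S| = r ->
  qbasis R r d (ord_list S) = Some b -> (S \in column_indep (qmx t r n d)) = b.
Proof.
move=> tP cS /(qstatP tP) <-.
rewrite (column_indep_ord_list
  (f := fun i j => qeval t (nth (0, 0)%ZZ (nth [::] d i) j))) //.
  congr (_ != _); apply/esym; apply: gdet_morph; rewrite ?/qeval //=.
  - by rewrite mul0r addr0.
  - by rewrite mul0r addr0.
  - exact: qevalD.
  - exact: qevalM.
  - exact: qevalN.
by move=> i j; rewrite mxE.
Qed.

(** * Comparing the bases of two matrices *)

(** Every independent set is completed from [S0] to an independent set of size [r], where the
    matrices agree. *)
Lemma agree_column_indep (F G : fieldType) (r n : nat) (A : 'M[F]_(r, n))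
    (B : 'M[G]_(r, n)) (S0 : {set 'I_n}) :
  agree_on A B xpredT -> #|S0| = r -> S0 \in column_indep A ->
  column_indep A = column_indep B.
Proof.
have sub (H K : fieldType) (E : 'M[H]_(r, n)) (E' : 'M[K]_(r, n)) :
    agree_on E E' xpredT -> #|S0| = r -> S0 \in column_indep E ->
    {subset column_indep E <= column_indep E'}.
  move=> EE' cS0 iS0 I iI.
  have [|L [iL sIL _ cL]] := @indep_extend _ (column_matroid E) I S0 iI iS0.
    by rewrite cS0 (column_indep_le iI).
  by apply: (columnS sIL); rewrite -EE' // cL.
move=> AB cS0 iS0; apply/setP => I; apply/idP/idP; first exact: sub AB cS0 iS0 I.
apply: sub => //; first by move=> S cS _; rewrite AB.
by rewrite -AB.
Qed.

(** Independence in a minor is expressed by ranks, which depend only on the independent sets; so the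
    minor of the matroid of [B] does the work. *)
Lemma eq_column_minor_representable (F G : fieldType) (r n : nat)
    (A : 'M[F]_(r, n)) (B : 'M[G]_(r, n)) (C D : {set 'I_n}) :
  column_indep A = column_indep B ->
  representable G (delete (contract (column_matroid A) C) D).
Proof.
move=> AB.
have eqrk X : rk (column_matroid B) X = rk (column_matroid A) X.
  by rewrite /rk /= AB.
apply: (@representable_eq _ _ (delete (contract (column_matroid B) C) D));
  [by [] | | exact: minor_representable].
apply/setP => I.
apply: etrans (minor_indepE (M := column_matroid B) D I (subsetT C)) _.
apply: etrans _ (esym (minor_indepE (M := column_matroid A) D I (subsetT C))).
by rewrite !eqrk.
Qed.

Section Check.
Variables (r n : nat).

(** The set [exc] is exempt; on all others the test must be conclusive and give the same answer. For
    [r > 0] the value [[::]] exempts nothing. *)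
Definition qagree (R1 R2 : qring) (d1 d2 : seq (seq (Z * Z))) (exc : seq nat) :=
  all (fun s => (s == exc) || (let a := qbasis R1 r d1 s in
                               (a != None) && (a == qbasis R2 r d2 s)))
      (comb r (iota 0 n)).

Lemma qagreeP (F1 F2 : fieldType) (t1 : F1) (t2 : F2) R1 R2 d1 d2 exc :
  qmodel R1 t1 -> qmodel R2 t2 -> qagree R1 R2 d1 d2 exc ->
  agree_on (qmx t1 r n d1) (qmx t2 r n d2) (fun S => ord_list S != exc).
Proof.
move=> m1 m2 /allP ag S cS nexc.
have := ag _ (ord_list_comb cS); rewrite (negbTE nexc) /=.
case E1: (qbasis R1 r d1 _) => [b|] //= /eqP/esym E2.
by rewrite (qbasisP m1 cS E1) (qbasisP m2 cS E2).
Qed.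

Lemma qbasis_column_indep (F1 : fieldType) (t1 : F1) R1 d1 (s : seq nat) :
  qmodel R1 t1 -> s \in comb r (iota 0 n) -> qbasis R1 r d1 s = Some true ->
  #|set_of_list n s| = r /\ set_of_list n s \in column_indep (qmx t1 r n d1).
Proof.
move=> m1 sc E; have [e c] := comb_ord_list sc.
by split=> //; rewrite (@qbasisP _ R1 _ _ _ _ _ true) ?e.
Qed.

(** The second condition supplies the basis [S0] needed to compare ranks: one that avoids [e] when
    [e] is in the exceptional set, and one that contains [e] otherwise. *)
Definition qrelax (R1 R2 : qring) (d1 : seq (seq (Z * Z)))
    (x : seq nat * seq (seq (Z * Z))) :=
  qagree R1 R2 d1 x.2 x.1 &&
  all (fun e => has (fun s => ((e \in s) == (e \notin x.1)) &&
                              (qbasis R1 r d1 s == Some true))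
                    (comb r (iota 0 n))) (iota 0 n).

(** Each element lies in one exceptional set, which serves its deletion, and outside another, which
    serves its contraction. *)
Definition qrelaxations R1 R2 d1 (L : seq (seq nat * seq (seq (Z * Z)))) :=
  all (qrelax R1 R2 d1) L &&
  all (fun e => has (fun x => e \in x.1) L && has (fun x => e \notin x.1) L)
      (iota 0 n).

(** Any removed element [e] selects a relaxation: if [e] is contracted, one whose exceptional set
    avoids [e]; if deleted, one whose exceptional set contains [e]. In both cases the minor does not
    see the exceptional set. *)
Lemma qrelaxations_minor (F1 F2 : fieldType) (t1 : F1) (t2 : F2) R1 R2 d1 L
    (N : matroid 'I_n) :
  qmodel R1 t1 -> qmodel R2 t2 -> qrelaxations R1 R2 d1 L ->
  proper_minor N (column_matroid (qmx t1 r n d1)) -> representable F2 N.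
Proof.
move=> m1 m2 /andP[/allP okL /allP cov] [C [D [_ _ dCD CD0 ->]]].
have {CD0} [e eCD] := set0Pn _ CD0.
have en : (e : nat) \in iota 0 n by rewrite mem_iota /= add0n.
have [x xL ex] : exists2 x, x \in L & e \in (if (e : nat) \notin x.1 then C else D).
  have /andP[/hasP[x xL ex] /hasP[y yL ey]] := cov _ en.
  move: eCD; rewrite inE => /orP[eC|eD]; first by exists y; rewrite // ey.
  by exists x; rewrite // ex.
have /andP[ag /allP/(_ _ en)/hasP[s sc /andP[/eqP es /eqP bs]]] := okL _ xL.
have [cS iS] := qbasis_column_indep m1 sc bs.
apply: (@agree_minor_representable _ _ _ _ _ (qmx t2 r n x.2) e
  ((e : nat) \notin x.1) (set_of_list n s)) => //; last by rewrite inE.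
move=> S cS' eS; apply: (qagreeP m1 m2 ag) => //.
by apply: contraTneq eS => <-; rewrite mem_ord_list; case: (e \in S).
Qed.

Lemma qagree_column_indep (F1 F2 : fieldType) (t1 : F1) (t2 : F2) R1 R2 d1 d2 :
  qmodel R1 t1 -> qmodel R2 t2 -> (0 < r)%N -> qagree R1 R2 d1 d2 [::] ->
  has (fun s => qbasis R1 r d1 s == Some true) (comb r (iota 0 n)) ->
  column_indep (qmx t1 r n d1) = column_indep (qmx t2 r n d2).
Proof.
move=> m1 m2 r0 ag /hasP[s sc /eqP bs].
have [cS iS] := qbasis_column_indep m1 sc bs.
apply: agree_column_indep cS iS => S cS _; apply: (qagreeP m1 m2 ag) => //.
by rewrite -size_eq0 size_map -cardE cS -lt0n.
Qed.

End Check.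

(** The algebraic closure of ['F_k] or of [rat]; the second clause provides the generator [t] of
    every quadratic ring below. *)
Lemma closed_field_of_char (k : nat) : prime k \/ k = 0%N ->
  exists2 K : closedFieldType, has_char K k
    & forall u v : K, exists t, t ^+ 2 = u * t + v.
Proof.
move=> kP.
have [F Fk] : exists F : countFieldType, has_char F k.
  case: kP => [pk | ->].
    exists 'F_k; rewrite /has_char eqn0Ngt prime_gt0 //=; exact: pchar_Fp.
  by exists rat; apply: Num.Theory.pchar_num.
have [K [f _]] := countable_algebraic_closure F.
exists K.
  move: Fk; rewrite /has_char; case: eqP => _ Fk; last by rewrite (fmorph_pchar f).
  by move=> p; rewrite (fmorph_pchar f).
move=> u v; have [t tP] := @solve_monicpoly K 2 (fun i => [:: v; u]`_i) isT.
exists t; rewrite tP !big_ord_recl big_ord0 /= expr0 expr1; ring.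
Qed.

Lemma zeval_nat (F : fieldType) (m : nat) : zeval F (Z.of_nat m) = m%:R.
Proof.
by rewrite /zeval /int_of_Z; case: m => [|m] //=; rewrite SuccNat2Pos.id_succ.
Qed.

(** * Self-duality through a permutation of the columns *)

Section Dual.
Variables (F : fieldType) (R : qring) (t : F) (r n : nat) (d : seq (seq (Z * Z))).

(** The list [p] sends column [i] to its [i]-th entry. An [r]-set must be a basis exactly when the
    complement of its image is one. *)
Definition qself_dual (p : seq nat) :=
  [&& size p == n, perm_eq p (iota 0 n), (n == r + r)%N,
      has (fun s => qbasis R r d s == Some true) (comb r (iota 0 n)) &
      all (fun s => let a := qbasis R r d s in (a != None) &&
             (a == qbasis R r d [seq x <- iota 0 n | x \notin [seq nth 0%N p i | i <- s]]))
          (comb r (iota 0 n))].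

Lemma qself_dualP p : qmodel R t -> qself_dual p ->
  isomorphic (column_matroid (qmx t r n d)) (dual (column_matroid (qmx t r n d))).
Proof.
move=> tm /and5P[/eqP sp pp /eqP nr /hasP[s0 s0c /eqP bs0] /allP ok].
set A := qmx t r n d; set M := column_matroid A.
have pi_lt (i : 'I_n) : (nth 0%N p i < n)%N.
  have : nth 0%N p i \in p by rewrite mem_nth ?sp.
  by rewrite (perm_mem pp) mem_iota.
pose pi (i : 'I_n) : 'I_n := Ordinal (pi_lt i).
have pi_inj : injective pi.
  move=> i j /(congr1 val) /= e; apply/val_inj/eqP.
  have up : uniq p by rewrite (perm_uniq pp) iota_uniq.
  by rewrite -(nth_uniq 0%N _ _ up) ?sp ?ltn_ord //; apply/eqP.
have [cS0 iS0] := qbasis_column_indep tm s0c bs0.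
have bE (B : {set 'I_n}) : (B \in bases M) = (#|B| == r) && (B \in column_indep A).
  apply/idP/andP => [bB|[/eqP cB iB]].
    have iB := bases_indep bB; split=> //.
    rewrite eqn_leq (column_indep_le iB) /= -cS0; exact: indep_le_basis bB.
  have [B' bB' sB'] := @basis_extend _ M B iB.
  have := card_basis bB' iB; apply.
  apply/eqP; rewrite eqn_leq subset_leq_card //= cB.
  exact: column_indep_le (bases_indep bB').
have card_setC (X : {set 'I_n}) : #|X| = r -> #|~: X| = r.
  move=> cX; have := cardsC X; rewrite cX card_ord => e.
  exact: (@addnI r) (etrans e nr).
have cardC (B : {set 'I_n}) : #|B| = r -> #|~: (pi @: B)| = r.
  by move=> cB; apply: card_setC; rewrite card_imset.
have piB (B : {set 'I_n}) : #|B| = r ->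
    (B \in column_indep A) = (~: (pi @: B) \in column_indep A).
  move=> cB; have := ok _ (ord_list_comb cB).
  have -> : [seq x <- iota 0 n | x \notin [seq nth 0%N p i | i <- ord_list B]] =
            ord_list (~: (pi @: B)).
    apply: (irr_sorted_eq ltn_trans ltnn).
    - apply: subseq_sorted ltn_trans _ _ _ (iota_ltn_sorted 0 n).
      exact: filter_subseq.
    - exact: subseq_sorted ltn_trans _ _ (subseq_ord_list _) (iota_ltn_sorted _ _).
    move=> x; rewrite mem_filter mem_iota /= add0n.
    have [xn|xn] := boolP (x < n)%N; last first.
      rewrite andbF; apply/esym/negP => /mapP[i _ xi].
      by rewrite xi ltn_ord in xn.
    rewrite andbT -[x in RHS]/(val (Ordinal xn)) mem_ord_list in_setC.
    congr (~~ _); apply/mapP/imsetP => [[_ /mapP[i + ->] xi]|[i iB /(congr1 val) /= xi]].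
      by rewrite mem_enum => iB; exists i => //; apply: val_inj.
    by exists (val i); rewrite // map_f ?mem_enum.
  case E: (qbasis R r d _) => [b|] //= /eqP/esym E'.
  by rewrite (qbasisP tm cB E) (qbasisP tm (cardC _ cB) E').
have extE I : (I \in column_indep A) = [exists B in bases M, I \subset B].
  apply/idP/existsP => [iI|[B /andP[bB sB]]].
    by have [B bB sB] := @basis_extend _ M I iI; exists B; rewrite bB.
  exact: columnS sB (bases_indep bB).
(* The image of [I] avoids a basis [B] exactly when [I] lies in the preimage of the complement of
   [B], which is again a basis by [piB]. *)
have dualE (I : {set 'I_n}) : (pi @: I \in indep (dual M)) = (I \in column_indep A).
  rewrite extE inE subsetT /=.
  apply/existsP/existsP => [[B /andP[bB dB]]|[B /andP[bB sB]]].
    move: bB; rewrite bE => /andP[/eqP cB iB].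
    pose B' := pi @^-1: (~: B).
    have piB' : pi @: B' = ~: B.
      have [g gK Kg] := injF_bij pi_inj.
      apply/setP => x; apply/imsetP/idP => [[y + ->]|xB]; first by rewrite inE.
      by exists (g x); rewrite ?Kg // inE Kg.
    have cB' : #|B'| = r.
      by rewrite -(card_imset _ pi_inj) piB' card_setC.
    exists B'; rewrite bE cB' eqxx piB // piB' setCK iB /=.
    apply/subsetP => x xI; rewrite inE in_setC; apply: contraL dB => xB.
    by apply/pred0Pn; exists (pi x); rewrite /= imset_f.
  move: bB; rewrite bE => /andP[/eqP cB iB].
  exists (~: (pi @: B)); rewrite bE cardC // eqxx -piB // iB /=.
  by rewrite disjoints_subset setCK imsetS.
pose f (x : {x : 'I_n | x \in ground M}) : {y : 'I_n | y \in ground (dual M)} :=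
  exist _ (pi (val x)) (in_setT _).
exists f.
  have [g gK Kg] := injF_bij pi_inj.
  pose h (y : {y : 'I_n | y \in ground (dual M)}) : {x : 'I_n | x \in ground M} :=
    exist _ (g (val y)) (in_setT _).
  exists h.
    by move=> x; apply: val_inj; rewrite /= gK.
  by move=> x; apply: val_inj; rewrite /= Kg.
by move=> I; rewrite -[RHS]dualE -imset_comp.
Qed.

End Dual.

(** * Normal forms of representations *)

(** The given vectors may live in a space of any dimension [m]. Those indexed by [h] form a basis of
    the space spanned by all of them, and [B] consists of coordinates in that basis. *)
Lemma representable_matrix (F G : fieldType) (r n : nat) (A : 'M[G]_(r, n))
    (h : 'I_r -> 'I_n) :
  injective h -> h @: 'I_r \in column_indep A ->
  representable F (column_matroid A) ->
  exists2 B : 'M[F]_(r, n), forall i j, B i (h j) = (i == j)%:R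
    & agree_on A B xpredT.
Proof.
move=> h_inj hA /representable_elim[m [v vP]].
have {}vP (I : {set 'I_n}) : (I \in column_indep A) = free [seq v i | i <- enum I].
  by rewrite -vP ?subsetT.
pose X : r.-tuple 'cV[F]_m := [tuple v (h i) | i < r].
have XE : X = [seq v i | i <- codom h] :> seq _ by rewrite codomE -map_comp.
have memh : h @: 'I_r =i codom h.
  by move=> x; apply/imsetP/codomP => [[i _ ->]|[i ->]]; exists i.
have uh : uniq (codom h) by rewrite map_inj_uniq ?enum_uniq.
have fX : free X by rewrite XE -(free_map_seq v uh memh) -vP.
have spanX j : v j \in <<X>>%VS.
  have [/codomP[i ->]|jh] := boolP (j \in codom h).
    by apply: memv_span; rewrite XE map_f ?codom_f.
  apply: contraT => nj.
  (* A vector outside the span would give [r + 1] independent columns of [A], which has only [r]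
     rows. *)
  have iS : j |: h @: 'I_r \in column_indep A.
    rewrite vP (@free_map_seq _ _ _ _ _ (j :: codom h)).
    - by rewrite /= free_cons -XE nj.
    - by rewrite /= jh.
    by move=> x; rewrite !inE memh.
  have := column_indep_le iS.
  by rewrite cardsU1 memh jh card_imset // card_ord ltnn.
pose B : 'M[F]_(r, n) := \matrix_(i, j) coord X i (v j).
exists B => [i j|S cS _].
  rewrite mxE; have -> : v (h j) = X`_j by rewrite -tnth_nth tnth_mktuple.
  by rewrite coord_free // eq_sym.
pose g (i : 'I_r) : 'I_n := enum_val (cast_ord (esym cS) i).
have g_inj : injective g by move=> i j /enum_val_inj/cast_ord_inj.
have Sg : S =i codom g.
  move=> x; apply/idP/codomP => [xS|[i ->]]; last exact: enum_valP.
  exists (cast_ord cS (enum_rank_in xS x)).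
  by rewrite /g cast_ordK enum_rankK_in.
have ug : uniq (codom g) by rewrite map_inj_uniq ?enum_uniq.
rewrite vP (free_map_seq v ug Sg) (column_indep_det _ g_inj Sg).
rewrite codomE -map_comp free_row_free -det_tr -unitfE -unitmxE -row_free_unit.
(* Passing from coordinates back to vectors multiplies by a matrix with independent rows, which
   preserves the rank. *)
have fW : row_free (\matrix_(i < r, l < m) v (h i) l 0).
  by rewrite -(free_row_free (fun i => v (h i))).
rewrite /row_free -(mxrankMfree _ fW).
congr (\rank _ == _); apply/matrixP => k l; rewrite !mxE.
rewrite {1}(coord_span (spanX (g k))) summxE; apply: eq_bigr => i _.
by rewrite !mxE -tnth_nth tnth_mktuple.
Qed.

Section Realization.
Variables (F : fieldType) (R : qring) (r n : nat) (d : seq (seq (Z * Z))).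

Definition minor_det (b : nat -> nat -> F) (s : seq nat) : F :=
  gdet 0 1 +%R *%R -%R r (fun i k => b i (nth 0%N s k)).

(** A matrix with identity in its first [r] columns and the zero pattern of minors prescribed by
    [d]. Entries are indexed by [nat] so that minors on explicit column lists unfold to
    polynomials. *)
Definition realization (b : nat -> nat -> F) : Prop :=
  (forall s v, s \in comb r (iota 0 n) -> qbasis R r d s = Some v ->
    (minor_det b s != 0) = v) /\
  (forall i j, (i < r)%N -> (j < r)%N -> b i j = (i == j)%:R).

Lemma minor_detE b s :
  minor_det b s = \det (\matrix_(i < r, k < r) b i (nth 0%N s k)).
Proof. exact: (@gdet_morph _ _ _ _ _ _ _ id). Qed.

Lemma representable_realization (G : fieldType) (t : G) :
  qmodel R t -> (r <= n)%N -> qbasis R r d (iota 0 r) = Some true ->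
  representable F (column_matroid (qmx t r n d)) -> exists b, realization b.
Proof.
move=> tm rn b0; pose h := widen_ord rn.
have h_inj : injective h by move=> i j /(congr1 val) /= /val_inj.
have s0c : iota 0 r \in comb r (iota 0 n).
  have : subseq (iota 0 r) (iota 0 n) by rewrite -(subnKC rn) iotaD prefix_subseq.
  by move/mem_comb; rewrite size_iota.
have [_ iS0] := qbasis_column_indep tm s0c b0.
have hS : h @: 'I_r = set_of_list n (iota 0 r).
  apply/setP => x; rewrite inE mem_iota /= add0n; apply/imsetP/idP => [[i _ ->]|xr].
    exact: (ltn_ord i).
  by exists (Ordinal xr) => //; apply: val_inj.
case/(representable_matrix h_inj); first by rewrite hS.
move=> B Bh AB.
pose b (i j : nat) : F :=
  if insub i is Some i' then if insub j is Some j' then B i' j' else 0 else 0.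
have bE i j : B i j = b i j by rewrite /b !valK.
exists b; split=> [s v sc sv|i j ir jr]; last first.
  have jn := leq_trans jr rn.
  rewrite -[i]/(val (Ordinal ir)) -[j in b _ j]/(val (h (Ordinal jr))) -bE Bh.
  by [].
have [e c] := comb_ord_list sc.
rewrite minor_detE -[s in LHS]e -(column_indep_ord_list bE) // -AB //.
by apply: (qbasisP tm) => //; rewrite e.
Qed.

(** Scaling rows by [x] and columns by nonzero factors multiplies every maximal minor by a nonzero
    scalar. The condition on [p] keeps the identity block. *)
Lemma realization_scale b (x : nat -> F) (p : nat -> nat) :
  realization b -> (forall i, x i != 0) ->
  (forall j, (j < n)%N -> b (p j) j != 0) -> (forall j, (j < r)%N -> p j = j) ->
  (r <= n)%N ->
  realization (fun i j => x i / x (p j) * (b i j / b (p j) j)).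
Proof.
move=> [bP bI] x0 bp pI rn; split=> [s v sc sv|i j ir jr]; last first.
  rewrite pI // !bI // eqxx divr1; case: eqP => [->|_]; last by rewrite mulr0.
  by rewrite mulr1 divff.
rewrite -(bP s v sc sv) !minor_detE.
have [e c] := comb_ord_list sc.
have sn k : (k < r)%N -> (nth 0 s k < n)%N.
  move=> kr; have /mapP[i _ ->] : nth 0%N s k \in ord_list (set_of_list n s).
    by rewrite e mem_nth // -e size_map -cardE c.
  exact: ltn_ord.
pose y j := (x (p j) * b (p j) j)^-1.
set M1 := (X in \det X != 0 = _); set M2 := (X in _ = (\det X != 0)).
have -> : M1 = diag_mx (\row_(i < r) x i) *m M2 *m
    diag_mx (\row_(k < r) y (nth 0%N s k)).
  apply/matrixP => i k; rewrite mul_mx_diag mul_diag_mx !mxE /y invfM.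
  by rewrite !mulrA; congr (_ * _); rewrite -!mulrA; congr (_ * _); rewrite mulrC.
rewrite !det_mulmx !det_diag !mulf_eq0 !negb_or.
have -> : \prod_(i < r) (\row_(i < r) x i) 0 i != 0.
  by apply/prodf_neq0 => i _; rewrite mxE.
have -> : \prod_(k < r) (\row_(k < r) y (nth 0%N s k)) 0 k != 0.
  by apply/prodf_neq0 => i _; rewrite mxE invr_eq0 mulf_neq0 // bp // sn.
by rewrite andbT.
Qed.

End Realization.

(** * Characteristics excluded by the vanishing minors *)

Definition gf4 := QRing 1 1 2 1.

(* Over GF(4): (0, 1) is alpha and (1, 1) is alpha + 1 = alpha ^ 2. *)
Definition dV1 : seq (seq (Z * Z)) :=
  [:: [:: (1,0); (0,0); (0,0); (1,0); (0,0); (1,0); (1,0); (1,0); (1,0)];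
      [:: (0,0); (1,0); (0,0); (1,0); (1,0); (1,1); (1,1); (0,1); (0,0)];
      [:: (0,0); (0,0); (1,0); (0,0); (1,0); (1,0); (0,1); (1,0); (0,1)]]%ZZ.

Definition dV2 : seq (seq (Z * Z)) :=
  [:: [:: (1,0); (0,0); (0,0); (0,0); (1,0); (1,0); (1,0); (0,0)];
      [:: (0,0); (1,0); (0,0); (0,0); (1,1); (0,1); (0,1); (1,0)];
      [:: (0,0); (0,0); (1,0); (0,0); (0,1); (1,1); (0,1); (1,0)];
      [:: (0,0); (0,0); (0,0); (1,0); (1,1); (1,1); (0,1); (0,1)]]%ZZ.

Definition dV3 : seq (seq (Z * Z)) :=
  [:: [:: (1,0); (0,0); (0,0); (0,0); (1,0); (0,0); (1,0); (1,0); (1,0)];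
      [:: (0,0); (1,0); (0,0); (0,0); (0,1); (1,0); (1,1); (1,1); (1,0)];
      [:: (0,0); (0,0); (1,0); (0,0); (0,1); (1,0); (0,1); (1,0); (1,1)];
      [:: (0,0); (0,0); (0,0); (1,0); (0,0); (1,0); (1,0); (0,0); (0,0)]]%ZZ.

Definition dP1 : seq (seq (Z * Z)) :=
  [:: [:: (0,0); (1,0); (1,0); (1,0); (1,0); (1,0); (0,0); (0,0); (0,0)];
      [:: (0,0); (1,0); (0,1); (0,0); (0,0); (0,0); (1,0); (1,0); (1,0)];
      [:: (1,0); (0,0); (0,0); (1,0); (0,1); (1,1); (1,0); (0,1); (1,1)]]%ZZ.

Definition dP2 : seq (seq (Z * Z)) :=
  [:: [:: (1,0); (0,0); (0,0); (0,0); (1,0); (0,0); (1,0); (1,0)];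
      [:: (0,0); (1,0); (0,0); (0,0); (0,1); (1,0); (1,0); (1,0)];
      [:: (0,0); (0,0); (1,0); (0,0); (1,0); (1,0); (0,0); (1,0)];
      [:: (0,0); (0,0); (0,0); (1,0); (1,1); (1,0); (1,1); (0,0)]]%ZZ.

Definition dP3 : seq (seq (Z * Z)) :=
  [:: [:: (0,0); (1,0); (1,0); (1,0); (1,0); (1,0); (1,0); (0,0); (0,0)];
      [:: (0,0); (1,0); (0,1); (1,1); (0,0); (0,0); (0,0); (1,0); (1,0)];
      [:: (1,0); (0,0); (0,0); (0,0); (1,0); (0,1); (1,1); (1,0); (0,1)]]%ZZ.

Section RealizationTheory.
Variables (F : fieldType) (R : qring) (r n : nat) (d : seq (seq (Z * Z))).
Variable b : nat -> nat -> F.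
Hypothesis bP : realization R r n d b.

(** Accepting either sign lets equations be written in a convenient form without tracking the sign
    of the expansion. *)
Lemma realization_eq0 s x : s \in comb r (iota 0 n) ->
  qbasis R r d s = Some false -> x = minor_det r b s \/ x = - minor_det r b s ->
  x = 0.
Proof.
case: bP => H _ sc sb; have /negbFE/eqP-> := H _ _ sc sb.
by rewrite oppr0; case.
Qed.

Lemma realization_neq0 s x : s \in comb r (iota 0 n) ->
  qbasis R r d s = Some true -> x = minor_det r b s \/ x = - minor_det r b s ->
  x != 0.
Proof.
by case: bP => H _ sc sb; have := H _ _ sc sb; move=> nz [] ->; rewrite ?oppr_eq0.
Qed.

(* Column j is scaled so that its entry in row p_j becomes 1; the scaling x   *)
(* of the rows remains free.                                                  *)
Lemma realization_normal (x : seq F) (p : seq nat) :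
  (r <= n)%N -> size x = r -> all (fun z => z != 0) x ->
  (forall j, (j < n)%N -> b (nth 0%N p j) j != 0) ->
  (forall j, (j < r)%N -> nth 0%N p j = j) ->
  exists b' : nat -> nat -> F, [/\ realization R r n d b',
    forall j, (j < n)%N -> b' (nth 0%N p j) j = 1 &
    forall i j, b' i j =
      nth 1 x i / nth 1 x (nth 0%N p j) * (b i j / b (nth 0%N p j) j)].
Proof.
move=> rn sx x0 bp pI.
have y0 i : nth 1 x i != 0.
  have [ix|ix] := ltnP i (size x); first exact: (allP x0) _ (mem_nth _ ix).
  by rewrite nth_default ?oner_neq0.
exists (fun i j => nth 1 x i / nth 1 x (nth 0%N p j) * (b i j / b (nth 0%N p j) j)).
split=> //; first exact: (realization_scale (p := nth 0%N p)).
by move=> j jn; rewrite !divff ?mulr1 // bp.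
Qed.

End RealizationTheory.

(** The product of equations acts as a single multi-rule for [rewrite]. *)
Lemma realization_id3 (F : fieldType) R n d (b : nat -> nat -> F) :
  realization R 3 n d b ->
  (((b 0%N 0%N = 1) * (b 0%N 1%N = 0) * (b 0%N 2%N = 0)) *
   ((b 1%N 0%N = 0) * (b 1%N 1%N = 1) * (b 1%N 2%N = 0)) *
   ((b 2%N 0%N = 0) * (b 2%N 1%N = 0) * (b 2%N 2%N = 1)))%type.
Proof. by move=> [_ bI]; rewrite !bI. Qed.

Lemma realization_id4 (F : fieldType) R n d (b : nat -> nat -> F) :
  realization R 4 n d b ->
  (((b 0%N 0%N = 1) * (b 0%N 1%N = 0) * (b 0%N 2%N = 0) * (b 0%N 3%N = 0)) *
   ((b 1%N 0%N = 0) * (b 1%N 1%N = 1) * (b 1%N 2%N = 0) * (b 1%N 3%N = 0)) *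
   ((b 2%N 0%N = 0) * (b 2%N 1%N = 0) * (b 2%N 2%N = 1) * (b 2%N 3%N = 0)) *
   ((b 3%N 0%N = 0) * (b 3%N 1%N = 0) * (b 3%N 2%N = 0) * (b 3%N 3%N = 1)))%type.
Proof. by move=> [_ bI]; rewrite !bI. Qed.

Lemma eq_of_sub0 (F : fieldType) (x y z : F) :
  z = 0 -> x - y = z \/ x - y = - z -> x = y.
Proof. by move=> -> []; rewrite ?oppr0; apply: subr0_eq. Qed.

Lemma mulf_eq0_l (F : fieldType) (x y z : F) :
  y != 0 -> z = 0 -> x * y = z \/ x * y = - z -> x = 0.
Proof.
by move=> y0 -> xy; apply/(mulIf y0); rewrite mul0r; case: xy; rewrite ?oppr0.
Qed.

Ltac minor_poly E :=
  rewrite /minor_det /= ?E /=; first [by left; ring | by right; ring].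
Ltac by_minor0 bP E s := apply: (realization_eq0 bP (s := s)) => //; minor_poly E.
Ltac by_minor1 bP E s := apply: (realization_neq0 bP (s := s)) => //; minor_poly E.
Ltac by_eq q := apply: (eq_of_sub0 q); first [by left; ring | by right; ring].

Local Notation "b @[ i , j ]" := (b i%N j%N) (at level 8, format "b @[ i ,  j ]").

(** With [y = c@[1, 6]], the vanishing minors express the third row through [y]; eliminating
    [c@[1, 7]] from the last two leaves [2 y^2 = 0] with [y] nonzero. *)
Lemma V1_two (F G : fieldType) (t : G) : qmodel gf4 t ->
  representable F (column_matroid (qmx t 3 9 dV1)) -> 2%:R = 0 :> F.
Proof.
move=> tm /(@representable_realization _ _ 3 9 dV1 _ _ tm isT erefl)[b bP].
have E := realization_id3 bP.
have n03 : b@[0, 3] != 0 by by_minor1 bP E [:: 1; 2; 3]%N.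
have n13 : b@[1, 3] != 0 by by_minor1 bP E [:: 0; 2; 3]%N.
have n14 : b@[1, 4] != 0 by by_minor1 bP E [:: 0; 2; 4]%N.
have n24 : b@[2, 4] != 0 by by_minor1 bP E [:: 0; 1; 4]%N.
have n05 : b@[0, 5] != 0 by by_minor1 bP E [:: 1; 2; 5]%N.
have n06 : b@[0, 6] != 0 by by_minor1 bP E [:: 1; 2; 6]%N.
have n07 : b@[0, 7] != 0 by by_minor1 bP E [:: 1; 2; 7]%N.
have n08 : b@[0, 8] != 0 by by_minor1 bP E [:: 1; 2; 8]%N.
(* These row factors make the entries [[1, 3]] and [[2, 4]] equal to 1 after the columns are
   normalized. *)
pose x1 := b@[0, 3] / b@[1, 3]; pose x2 := x1 * b@[1, 4] / b@[2, 4].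
have [//|//||||c [cP c1 cE]] := realization_normal bP (x := [:: 1; x1; x2])
  (p := [:: 0; 1; 2; 0; 1; 0; 0; 0; 0]%N).
- by rewrite /= oner_neq0 !(mulf_neq0, invr_eq0).
- by do 9![case; first by rewrite /= ?E ?oner_neq0].
- by do 3![case=> //].
have N := (oner_neq0 F, n03, n13, n14, n24).
have c13 : c@[1, 3] = 1 by rewrite cE /= /x1; field; rewrite ?N.
have c24 : c@[2, 4] = 1 by rewrite cE /= /x2 /x1; field; rewrite ?N.
have {}E := (realization_id3 cP, c1 3%N isT, c1 4%N isT, c1 5%N isT, c1 6%N isT,
  c1 7%N isT, c1 8%N isT, c13, c24).
have e23 : c@[2, 3] = 0 by by_minor0 cP E [:: 0; 1; 3]%N.
have e04 : c@[0, 4] = 0 by by_minor0 cP E [:: 1; 2; 4]%N.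
have e18 : c@[1, 8] = 0 by by_minor0 cP E [:: 0; 2; 8]%N.
have {}E := (E, e23, e04, e18).
have y0 : c@[1, 6] != 0 by by_minor1 cP E [:: 0; 2; 6]%N.
have q256 : c@[1, 6] - c@[1, 5] = 0 by by_minor0 cP E [:: 2; 5; 6]%N.
have q157 : c@[2, 7] - c@[2, 5] = 0 by by_minor0 cP E [:: 1; 5; 7]%N.
have q168 : c@[2, 8] - c@[2, 6] = 0 by by_minor0 cP E [:: 1; 6; 8]%N.
have q346 : c@[2, 6] - c@[1, 6] + 1 = 0 by by_minor0 cP E [:: 3; 4; 6]%N.
have q458 : c@[2, 5] - c@[1, 5] - c@[2, 8] = 0 by by_minor0 cP E [:: 4; 5; 8]%N.
have q067 : c@[1, 6] * c@[2, 7] - c@[1, 7] * c@[2, 6] = 0.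
  by by_minor0 cP E [:: 0; 6; 7]%N.
have q378 : c@[1, 7] * c@[2, 8] - c@[2, 8] + c@[2, 7] = 0.
  by by_minor0 cP E [:: 3; 7; 8]%N.
have e15 : c@[1, 5] = c@[1, 6] by by_eq q256.
have e28 : c@[2, 8] = c@[2, 6] by by_eq q168.
have e26 : c@[2, 6] = c@[1, 6] - 1 by by_eq q346.
have e27 : c@[2, 7] = c@[2, 5] by by_eq q157.
have e25 : c@[2, 5] = c@[1, 6] + c@[2, 6] by rewrite -e15 -e28; by_eq q458.
(* Since [c@[2, 8] = c@[2, 6]], the terms in [c@[1, 7]] cancel in this sum. *)
have q : c@[1, 6] * c@[2, 7] - c@[1, 7] * c@[2, 6] +
  (c@[1, 7] * c@[2, 8] - c@[2, 8] + c@[2, 7]) = 0 by rewrite q067 q378 addr0.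
apply: (mulf_eq0_l (expf_neq0 2 y0) q).
by rewrite e28 e27 e25 e26; left; ring.
Qed.

(** Both [c@[2, 7]] and [c@[2, 5]] are inverse to [c@[1, 5]], so they equal a common [x], and the
    last minor becomes [2 (1 - x) = 0] with [x] different from 1. *)
Lemma V2_two (F G : fieldType) (t : G) : qmodel gf4 t ->
  representable F (column_matroid (qmx t 4 8 dV2)) -> 2%:R = 0 :> F.
Proof.
move=> tm /(@representable_realization _ _ 4 8 dV2 _ _ tm isT erefl)[b bP].
have E := realization_id4 bP.
have n04 : b@[0, 4] != 0 by by_minor1 bP E [:: 1; 2; 3; 4]%N.
have n14 : b@[1, 4] != 0 by by_minor1 bP E [:: 0; 2; 3; 4]%N.
have n24 : b@[2, 4] != 0 by by_minor1 bP E [:: 0; 1; 3; 4]%N.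
have n34 : b@[3, 4] != 0 by by_minor1 bP E [:: 0; 1; 2; 4]%N.
have n05 : b@[0, 5] != 0 by by_minor1 bP E [:: 1; 2; 3; 5]%N.
have n06 : b@[0, 6] != 0 by by_minor1 bP E [:: 1; 2; 3; 6]%N.
have n17 : b@[1, 7] != 0 by by_minor1 bP E [:: 0; 2; 3; 7]%N.
have [//|//||||c [cP c1 cE]] := realization_normal bP
  (x := [:: b@[0, 4]^-1; b@[1, 4]^-1; b@[2, 4]^-1; b@[3, 4]^-1])
  (p := [:: 0; 1; 2; 3; 0; 0; 0; 1]%N).
- by rewrite /= !invr_eq0 n04 n14 n24 n34.
- by do 8![case; first by rewrite /= ?E ?oner_neq0].
- by do 4![case=> //].
have N := (oner_neq0 F, n04, n14, n24, n34).
have c14 : c@[1, 4] = 1 by rewrite cE /=; field; rewrite ?N.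
have c24 : c@[2, 4] = 1 by rewrite cE /=; field; rewrite ?N.
have c34 : c@[3, 4] = 1 by rewrite cE /=; field; rewrite ?N.
have {}E := (realization_id4 cP, c1 4%N isT, c1 5%N isT, c1 6%N isT,
  c1 7%N isT, c14, c24, c34).
have e07 : c@[0, 7] = 0 by by_minor0 cP E [:: 1; 2; 3; 7]%N.
have {}E := (E, e07).
have x1 : c@[2, 7] - 1 != 0 by by_minor1 cP E [:: 0; 3; 4; 7]%N.
have q0147 : c@[3, 7] - c@[2, 7] = 0 by by_minor0 cP E [:: 0; 1; 4; 7]%N.
have q0246 : c@[3, 6] - c@[1, 6] = 0 by by_minor0 cP E [:: 0; 2; 4; 6]%N.
have q1245 : c@[3, 5] - 1 = 0 by by_minor0 cP E [:: 1; 2; 4; 5]%N.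
have q1346 : c@[2, 6] - 1 = 0 by by_minor0 cP E [:: 1; 3; 4; 6]%N.
have q2356 : c@[1, 6] - c@[1, 5] = 0 by by_minor0 cP E [:: 2; 3; 5; 6]%N.
have q0257 : c@[1, 5] * c@[3, 7] - c@[3, 5] = 0 by by_minor0 cP E [:: 0; 2; 5; 7]%N.
have q0156 : c@[2, 5] * c@[3, 6] - c@[3, 5] * c@[2, 6] = 0.
  by by_minor0 cP E [:: 0; 1; 5; 6]%N.
have q3457 : c@[1, 5] * c@[2, 7] - c@[2, 5] - c@[2, 7] + 1 = 0.
  by by_minor0 cP E [:: 3; 4; 5; 7]%N.
have e37 : c@[3, 7] = c@[2, 7] by by_eq q0147.
have e16 : c@[1, 6] = c@[1, 5] by by_eq q2356.
have e36 : c@[3, 6] = c@[1, 5] by rewrite -e16; by_eq q0246.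
have e35 : c@[3, 5] = 1 by by_eq q1245.
have e26 : c@[2, 6] = 1 by by_eq q1346.
have px : c@[1, 5] * c@[2, 7] = 1 by rewrite -e37 -e35; by_eq q0257.
have qp : c@[2, 5] * c@[1, 5] = 1.
  by have := subr0_eq q0156; rewrite e36 e35 e26 mulr1.
have e25 : c@[2, 5] = c@[2, 7].
  by rewrite -[LHS]mulr1 -px mulrA qp mul1r.
apply: (mulf_eq0_l x1 q3457).
by rewrite px e25; right; ring.
Qed.

(** Each vanishing minor expresses one more entry through [s = c@[3, 6]], until the minor on columns
    0, 5, 6, 7 reads [2 s^2 = 0] with [s] nonzero. *)
Lemma V3_two (F G : fieldType) (t : G) : qmodel gf4 t ->
  representable F (column_matroid (qmx t 4 9 dV3)) -> 2%:R = 0 :> F.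
Proof.
move=> tm /(@representable_realization _ _ 4 9 dV3 _ _ tm isT erefl)[b bP].
have E := realization_id4 bP.
have n04 : b@[0, 4] != 0 by by_minor1 bP E [:: 1; 2; 3; 4]%N.
have n14 : b@[1, 4] != 0 by by_minor1 bP E [:: 0; 2; 3; 4]%N.
have n15 : b@[1, 5] != 0 by by_minor1 bP E [:: 0; 2; 3; 5]%N.
have n25 : b@[2, 5] != 0 by by_minor1 bP E [:: 0; 1; 3; 5]%N.
have n35 : b@[3, 5] != 0 by by_minor1 bP E [:: 0; 1; 2; 5]%N.
have n06 : b@[0, 6] != 0 by by_minor1 bP E [:: 1; 2; 3; 6]%N.
have n07 : b@[0, 7] != 0 by by_minor1 bP E [:: 1; 2; 3; 7]%N.
have n08 : b@[0, 8] != 0 by by_minor1 bP E [:: 1; 2; 3; 8]%N.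
have [//|//||||c [cP c1 cE]] := realization_normal bP
  (x := [:: b@[1, 4] / b@[0, 4] / b@[1, 5]; b@[1, 5]^-1; b@[2, 5]^-1; b@[3, 5]^-1])
  (p := [:: 0; 1; 2; 3; 0; 1; 0; 0; 0]%N).
- by rewrite /= !(mulf_neq0, invr_eq0) ?n15 ?n25 ?n35.
- by do 9![case; first by rewrite /= ?E ?oner_neq0].
- by do 4![case=> //].
have N := (oner_neq0 F, n04, n14, n15, n25, n35).
have c14 : c@[1, 4] = 1 by rewrite cE /=; field; rewrite ?N.
have c25 : c@[2, 5] = 1 by rewrite cE /=; field; rewrite ?N.
have c35 : c@[3, 5] = 1 by rewrite cE /=; field; rewrite ?N.
have {}E := (realization_id4 cP, c1 4%N isT, c1 5%N isT, c1 6%N isT,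
  c1 7%N isT, c1 8%N isT, c14, c25, c35).
have e05 : c@[0, 5] = 0 by by_minor0 cP E [:: 1; 2; 3; 5]%N.
have e34 : c@[3, 4] = 0 by by_minor0 cP E [:: 0; 1; 2; 4]%N.
have e37 : c@[3, 7] = 0 by by_minor0 cP E [:: 0; 1; 2; 7]%N.
have e38 : c@[3, 8] = 0 by by_minor0 cP E [:: 0; 1; 2; 8]%N.
have {}E := (E, e05, e34, e37, e38).
have t0 : c@[3, 6] != 0 by by_minor1 cP E [:: 0; 1; 2; 6]%N.
have q0345 : c@[2, 4] - 1 = 0 by by_minor0 cP E [:: 0; 3; 4; 5]%N.
have {}E := (E, subr0_eq q0345).
have q1346 : c@[2, 6] - 1 = 0 by by_minor0 cP E [:: 1; 3; 4; 6]%N.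
have {}E := (E, subr0_eq q1346).
have q2367 : c@[1, 7] - c@[1, 6] = 0 by by_minor0 cP E [:: 2; 3; 6; 7]%N.
have {}E := (E, subr0_eq q2367).
have q2456 : c@[3, 6] - c@[1, 6] + 1 = 0 by by_minor0 cP E [:: 2; 4; 5; 6]%N.
have e16 : c@[1, 6] = c@[3, 6] + 1 by by_eq q2456.
have {}E := (E, e16).
have q1568 : c@[3, 6] + c@[2, 8] - 1 = 0 by by_minor0 cP E [:: 1; 5; 6; 8]%N.
have e28 : c@[2, 8] = 1 - c@[3, 6] by by_eq q1568.
have {}E := (E, e28).
have q0368 : (c@[3, 6] + 1) * (1 - c@[3, 6]) - c@[1, 8] = 0.
  by by_minor0 cP E [:: 0; 3; 6; 8]%N.
have e18 : c@[1, 8] = (c@[3, 6] + 1) * (1 - c@[3, 6]) by by_eq q0368.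
have {}E := (E, e18).
have q3578 : c@[2, 7] - (1 - c@[3, 6]) + (c@[3, 6] + 1) * (1 - c@[3, 6]) -
  (c@[3, 6] + 1) = 0 by by_minor0 cP E [:: 3; 5; 7; 8]%N.
have e27 : c@[2, 7] = 1 + c@[3, 6] ^+ 2 by by_eq q3578.
have {}E := (E, e27).
have q : 2%:R * c@[3, 6] ^+ 2 = 0 by by_minor0 cP E [:: 0; 5; 6; 7]%N.
by apply: (mulf_eq0_l (expf_neq0 2 t0) q); left.
Qed.

(** The entry [k = c@[1, 5]] satisfies [k^3 = 1] and differs from 1, so [k^2 + k + 1 = 0]. If
    [3 = 0], this polynomial is [(k - 1)^2], which is nonzero. *)
Lemma P1_three (F G : fieldType) (t : G) : qmodel gf4 t ->
  representable F (column_matroid (qmx t 3 9 dP1)) -> 3%:R != 0 :> F.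
Proof.
move=> tm /(@representable_realization _ _ 3 9 dP1 _ _ tm isT erefl)[b bP].
have E := realization_id3 bP.
have n03 : b@[0, 3] != 0 by by_minor1 bP E [:: 1; 2; 3]%N.
have n13 : b@[1, 3] != 0 by by_minor1 bP E [:: 0; 2; 3]%N.
have n23 : b@[2, 3] != 0 by by_minor1 bP E [:: 0; 1; 3]%N.
have n04 : b@[0, 4] != 0 by by_minor1 bP E [:: 1; 2; 4]%N.
have n05 : b@[0, 5] != 0 by by_minor1 bP E [:: 1; 2; 5]%N.
have n06 : b@[0, 6] != 0 by by_minor1 bP E [:: 1; 2; 6]%N.
have n07 : b@[0, 7] != 0 by by_minor1 bP E [:: 1; 2; 7]%N.
have n08 : b@[0, 8] != 0 by by_minor1 bP E [:: 1; 2; 8]%N.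
have [//|//||||c [cP c1 cE]] := realization_normal bP
  (x := [:: b@[0, 3]^-1; b@[1, 3]^-1; b@[2, 3]^-1])
  (p := [:: 0; 1; 2; 0; 0; 0; 0; 0; 0]%N).
- by rewrite /= !invr_eq0 n03 n13 n23.
- by do 9![case; first by rewrite /= ?E ?oner_neq0].
- by do 3![case=> //].
have N := (oner_neq0 F, n03, n13, n23).
have c13 : c@[1, 3] = 1 by rewrite cE /=; field; rewrite ?N.
have c23 : c@[2, 3] = 1 by rewrite cE /=; field; rewrite ?N.
have {}E := (realization_id3 cP, c1 3%N isT, c1 4%N isT, c1 5%N isT, c1 6%N isT,
  c1 7%N isT, c1 8%N isT, c13, c23).
have q034 : c@[2, 4] - c@[1, 4] = 0 by by_minor0 cP E [:: 0; 3; 4]%N.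
have q035 : c@[2, 5] - c@[1, 5] = 0 by by_minor0 cP E [:: 0; 3; 5]%N.
have q136 : c@[2, 6] - 1 = 0 by by_minor0 cP E [:: 1; 3; 6]%N.
have q238 : c@[1, 8] - 1 = 0 by by_minor0 cP E [:: 2; 3; 8]%N.
have {}E := (E, subr0_eq q034, subr0_eq q035, subr0_eq q136, subr0_eq q238).
have q147 : c@[2, 7] - c@[1, 4] = 0 by by_minor0 cP E [:: 1; 4; 7]%N.
have q158 : c@[2, 8] - c@[1, 5] = 0 by by_minor0 cP E [:: 1; 5; 8]%N.
have q246 : c@[1, 6] - c@[1, 4] = 0 by by_minor0 cP E [:: 2; 4; 6]%N.
have q257 : c@[1, 7] - c@[1, 5] = 0 by by_minor0 cP E [:: 2; 5; 7]%N.
have {}E := (E, subr0_eq q147, subr0_eq q158, subr0_eq q246, subr0_eq q257).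
have q068 : c@[1, 4] * c@[1, 5] - 1 = 0 by by_minor0 cP E [:: 0; 6; 8]%N.
have q078 : c@[1, 5] * c@[1, 5] - c@[1, 4] = 0 by by_minor0 cP E [:: 0; 7; 8]%N.
have e14 : c@[1, 4] = c@[1, 5] ^+ 2 by by_eq q078.
have k1 : c@[1, 5] - 1 != 0 by by_minor1 cP E [:: 1; 3; 5]%N.
have q : c@[1, 5] ^+ 2 + c@[1, 5] + 1 = 0.
  by apply: (mulf_eq0_l k1 q068); rewrite e14; left; ring.
apply: contra_neq (expf_neq0 2 k1) => three.
have -> : (c@[1, 5] - 1) ^+ 2 = c@[1, 5] ^+ 2 + c@[1, 5] + 1 - 3%:R * c@[1, 5] by ring.
by rewrite q three mul0r subr0.
Qed.

(** Let [p = c@[2, 5]], [s = c@[3, 5]] and [m = c@[1, 6]]. The three last equations add up to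
    [s + p = 3]. If [3 = 0], then [s = - p], and [p m = 1] turns [s - s m - 1 = 0] into [p = 0]. *)
Lemma P2_three (F G : fieldType) (t : G) : qmodel gf4 t ->
  representable F (column_matroid (qmx t 4 8 dP2)) -> 3%:R != 0 :> F.
Proof.
move=> tm /(@representable_realization _ _ 4 8 dP2 _ _ tm isT erefl)[b bP].
have E := realization_id4 bP.
have n04 : b@[0, 4] != 0 by by_minor1 bP E [:: 1; 2; 3; 4]%N.
have n14 : b@[1, 4] != 0 by by_minor1 bP E [:: 0; 2; 3; 4]%N.
have n24 : b@[2, 4] != 0 by by_minor1 bP E [:: 0; 1; 3; 4]%N.
have n34 : b@[3, 4] != 0 by by_minor1 bP E [:: 0; 1; 2; 4]%N.
have n15 : b@[1, 5] != 0 by by_minor1 bP E [:: 0; 2; 3; 5]%N.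
have n06 : b@[0, 6] != 0 by by_minor1 bP E [:: 1; 2; 3; 6]%N.
have n07 : b@[0, 7] != 0 by by_minor1 bP E [:: 1; 2; 3; 7]%N.
have [//|//||||c [cP c1 cE]] := realization_normal bP
  (x := [:: b@[0, 4]^-1; b@[1, 4]^-1; b@[2, 4]^-1; b@[3, 4]^-1])
  (p := [:: 0; 1; 2; 3; 0; 1; 0; 0]%N).
- by rewrite /= !invr_eq0 n04 n14 n24 n34.
- by do 8![case; first by rewrite /= ?E ?oner_neq0].
- by do 4![case=> //].
have N := (oner_neq0 F, n04, n14, n24, n34).
have c14 : c@[1, 4] = 1 by rewrite cE /=; field; rewrite ?N.
have c24 : c@[2, 4] = 1 by rewrite cE /=; field; rewrite ?N.
have c34 : c@[3, 4] = 1 by rewrite cE /=; field; rewrite ?N.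
have {}E := (realization_id4 cP, c1 4%N isT, c1 5%N isT, c1 6%N isT,
  c1 7%N isT, c14, c24, c34).
have e05 : c@[0, 5] = 0 by by_minor0 cP E [:: 1; 2; 3; 5]%N.
have e26 : c@[2, 6] = 0 by by_minor0 cP E [:: 0; 1; 3; 6]%N.
have e37 : c@[3, 7] = 0 by by_minor0 cP E [:: 0; 1; 2; 7]%N.
have {}E := (E, e05, e26, e37).
have q1246 : c@[3, 6] - 1 = 0 by by_minor0 cP E [:: 1; 2; 4; 6]%N.
have q1347 : c@[2, 7] - 1 = 0 by by_minor0 cP E [:: 1; 3; 4; 7]%N.
have q2367 : c@[1, 7] - c@[1, 6] = 0 by by_minor0 cP E [:: 2; 3; 6; 7]%N.
have {}E := (E, subr0_eq q1246, subr0_eq q1347, subr0_eq q2367).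
have p0 : c@[2, 5] != 0 by by_minor1 cP E [:: 0; 1; 3; 5]%N.
have q0357 : c@[2, 5] * c@[1, 6] - 1 = 0 by by_minor0 cP E [:: 0; 3; 5; 7]%N.
have q2457 : c@[3, 5] - c@[3, 5] * c@[1, 6] - 1 = 0.
  by by_minor0 cP E [:: 2; 4; 5; 7]%N.
have q0456 : c@[2, 5] - 1 + c@[3, 5] * c@[1, 6] - c@[2, 5] * c@[1, 6] = 0.
  by by_minor0 cP E [:: 0; 4; 5; 6]%N.
apply: contra_neq (expf_neq0 2 p0) => three.
have e35 : c@[3, 5] = 3%:R - c@[2, 5].
  apply: (eq_of_sub0 (z := (c@[3, 5] - c@[3, 5] * c@[1, 6] - 1) +
    (c@[2, 5] - 1 + c@[3, 5] * c@[1, 6] - c@[2, 5] * c@[1, 6]) +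
    (c@[2, 5] * c@[1, 6] - 1))).
    by rewrite q2457 q0456 q0357 !addr0.
  by left; ring.
have {}e35 : c@[3, 5] = - c@[2, 5] by rewrite e35 three sub0r.
have -> : c@[2, 5] ^+ 2 = (c@[2, 5] * c@[1, 6] - 1) * c@[2, 5] - c@[2, 5] *
  (- c@[2, 5] - - c@[2, 5] * c@[1, 6] - 1).
  by ring.
by rewrite -e35 q2457 q0357 mul0r mulr0 subr0.
Qed.

(** With [a = c@[1, 5]], the minors give [c@[1, 6] = a^2] and [c@[2, 4] = a + 1]; the last one is
    then [(a - 1) (a^2 + a + 1)], whose second factor would be [(a - 1)^2] if [3 = 0]. *)
Lemma P3_three (F G : fieldType) (t : G) : qmodel gf4 t ->
  representable F (column_matroid (qmx t 3 9 dP3)) -> 3%:R != 0 :> F.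
Proof.
move=> tm /(@representable_realization _ _ 3 9 dP3 _ _ tm isT erefl)[b bP].
have E := realization_id3 bP.
have n13 : b@[1, 3] != 0 by by_minor1 bP E [:: 0; 2; 3]%N.
have n23 : b@[2, 3] != 0 by by_minor1 bP E [:: 0; 1; 3]%N.
have n04 : b@[0, 4] != 0 by by_minor1 bP E [:: 1; 2; 4]%N.
have n14 : b@[1, 4] != 0 by by_minor1 bP E [:: 0; 2; 4]%N.
have n05 : b@[0, 5] != 0 by by_minor1 bP E [:: 1; 2; 5]%N.
have n06 : b@[0, 6] != 0 by by_minor1 bP E [:: 1; 2; 6]%N.
have n07 : b@[0, 7] != 0 by by_minor1 bP E [:: 1; 2; 7]%N.
have n08 : b@[0, 8] != 0 by by_minor1 bP E [:: 1; 2; 8]%N.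
have [//|//||||c [cP c1 cE]] := realization_normal bP
  (x := [:: b@[1, 4] / b@[0, 4] / b@[1, 3]; b@[1, 3]^-1; b@[2, 3]^-1])
  (p := [:: 0; 1; 2; 1; 0; 0; 0; 0; 0]%N).
- by rewrite /= !(mulf_neq0, invr_eq0) ?n13 ?n23.
- by do 9![case; first by rewrite /= ?E ?oner_neq0].
- by do 3![case=> //].
have N := (oner_neq0 F, n13, n23, n04, n14).
have c23 : c@[2, 3] = 1 by rewrite cE /=; field; rewrite ?N.
have c14 : c@[1, 4] = 1 by rewrite cE /=; field; rewrite ?N.
have {}E := (realization_id3 cP, c1 3%N isT, c1 4%N isT, c1 5%N isT, c1 6%N isT,
  c1 7%N isT, c1 8%N isT, c23, c14).
have e03 : c@[0, 3] = 0 by by_minor0 cP E [:: 1; 2; 3]%N.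
have {}E := (E, e03).
have k0 : c@[2, 4] != 0 by by_minor1 cP E [:: 0; 1; 4]%N.
have q045 : c@[2, 5] - c@[2, 4] * c@[1, 5] = 0 by by_minor0 cP E [:: 0; 4; 5]%N.
have q046 : c@[2, 6] - c@[2, 4] * c@[1, 6] = 0 by by_minor0 cP E [:: 0; 4; 6]%N.
have q147 : c@[2, 7] - c@[2, 4] = 0 by by_minor0 cP E [:: 1; 4; 7]%N.
have q257 : c@[1, 7] - c@[1, 5] = 0 by by_minor0 cP E [:: 2; 5; 7]%N.
have q268 : c@[1, 8] - c@[1, 6] = 0 by by_minor0 cP E [:: 2; 6; 8]%N.
have {}E := (E, subr0_eq q045, subr0_eq q046, subr0_eq q147, subr0_eq q257,
  subr0_eq q268).
have q158 : c@[2, 8] - c@[2, 4] * c@[1, 5] = 0 by by_minor0 cP E [:: 1; 5; 8]%N.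
have {}E := (E, subr0_eq q158).
have a1 : c@[1, 5] - 1 != 0 by by_minor1 cP E [:: 2; 4; 5]%N.
have q078 : c@[1, 5] * (c@[2, 4] * c@[1, 5]) - c@[2, 4] * c@[1, 6] = 0.
  by by_minor0 cP E [:: 0; 7; 8]%N.
have q348 : c@[2, 4] * c@[1, 5] - c@[2, 4] - c@[1, 6] + 1 = 0.
  by by_minor0 cP E [:: 3; 4; 8]%N.
have q367 : c@[2, 4] * c@[1, 6] - c@[2, 4] - c@[1, 6] + c@[1, 5] = 0.
  by by_minor0 cP E [:: 3; 6; 7]%N.
have e16 : c@[1, 6] = c@[1, 5] ^+ 2.
  apply/subr0_eq/(mulf_eq0_l k0 q078); right; ring.
have e24 : c@[2, 4] = c@[1, 5] + 1.
  by apply/subr0_eq/(mulf_eq0_l a1 q348); rewrite e16; left; ring.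
have q : c@[1, 5] ^+ 2 + c@[1, 5] + 1 = 0.
  by apply: (mulf_eq0_l a1 q367); rewrite e24 e16; left; ring.
apply: contra_neq (expf_neq0 2 a1) => three.
have -> : (c@[1, 5] - 1) ^+ 2 = c@[1, 5] ^+ 2 + c@[1, 5] + 1 - 3%:R * c@[1, 5] by ring.
by rewrite q three mul0r subr0.
Qed.

(** * Relaxations *)

(** In [golden] only elements of norm 1 or -1 are accepted as nonzero, so its results hold in every
    characteristic. [golden3] reduces modulo 3. In [eisenstein] the entry [qn = 3] records that 3 is
    nonzero. *)
Definition golden := QRing 1 1 0 1.
Definition golden3 := QRing 1 1 3 1.
Definition eisenstein := QRing (-1) (-1) 0 3.

(* Each item is an exceptional set S followed by a matrix with the same bases *)
(* except possibly at S.                                                      *)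
Definition relaxV1 : seq (seq nat * seq (seq (Z * Z))) :=
  [:: ([:: 0; 2; 8]%N,
     [:: [:: (1,0); (1,0); (0,0); (0,0); (1,0); (1,0); (1,0); (1,0); (1,0)];
         [:: (0,0); (0,0); (1,0); (0,0); (1,0); (1,1); (1,0); (0,-1); (0,-1)];
         [:: (2,-1); (0,0); (0,0); (1,0); (0,0); (1,0); (1,0); (1,-1); (0,-1)]]%ZZ);
      ([:: 1; 5; 7]%N,
     [:: [:: (1,0); (1,0); (0,0); (0,0); (1,0); (1,0); (1,0); (1,0); (1,0)];
         [:: (0,0); (0,0); (1,0); (0,0); (1,0); (0,1); (1,0); (1,1); (1,1)];
         [:: (0,0); (1,0); (0,0); (1,0); (1,0); (-1,1); (-1,1); (0,1); (0,0)]]%ZZ);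
      ([:: 3; 4; 6]%N,
     [:: [:: (1,0); (0,0); (0,0); (1,0); (0,0); (1,0); (1,0); (1,0); (1,0)];
         [:: (0,0); (1,0); (0,0); (0,-1); (1,0); (1,0); (1,0); (1,1); (0,0)];
         [:: (0,0); (0,0); (1,0); (0,0); (1,0); (0,1); (-1,1); (0,1); (-1,1)]]%ZZ)].

Definition relaxV2 : seq (seq nat * seq (seq (Z * Z))) :=
  [:: ([:: 0; 1; 5; 6]%N,
     [:: [:: (1,0); (1,0); (0,0); (0,0); (0,0); (1,0); (1,0); (1,0)];
         [:: (-1,1); (0,0); (1,0); (0,0); (0,0); (1,0); (0,0); (1,0)];
         [:: (1,0); (0,0); (0,0); (1,0); (0,0); (0,0); (1,0); (0,1)];
         [:: (2,-1); (0,0); (0,0); (0,0); (1,0); (1,0); (1,0); (0,0)]]%ZZ);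
      ([:: 3; 4; 5; 7]%N,
     [:: [:: (1,0); (0,0); (0,0); (1,0); (0,0); (0,0); (1,0); (1,0)];
         [:: (0,0); (1,0); (0,0); (-1,1); (0,0); (1,0); (0,0); (0,1)];
         [:: (0,0); (0,0); (1,0); (1,0); (0,0); (1,0); (1,0); (0,0)];
         [:: (0,0); (0,0); (0,0); (0,1); (1,0); (1,0); (1,0); (0,1)]]%ZZ);
      ([:: 0; 2; 4; 6]%N,
     [:: [:: (1,0); (0,0); (1,0); (0,0); (0,0); (1,0); (0,0); (1,0)];
         [:: (0,0); (1,0); (0,1); (0,0); (0,0); (1,0); (1,0); (1,0)];
         [:: (0,0); (0,0); (1,0); (1,0); (0,0); (1,0); (1,1); (0,0)];
         [:: (0,0); (0,0); (1,1); (0,0); (1,0); (1,0); (1,1); (1,1)]]%ZZ)].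

Definition relaxV3 : seq (seq nat * seq (seq (Z * Z))) :=
  [:: ([:: 0; 3; 4; 5]%N,
     [:: [:: (1,0); (1,0); (0,0); (0,0); (0,0); (1,0); (1,0); (1,0); (1,0)];
         [:: (-1,0); (0,0); (1,0); (0,0); (0,0); (1,0); (0,0); (-1,1); (0,1)];
         [:: (0,0); (0,0); (0,0); (1,0); (0,0); (1,0); (1,0); (0,0); (0,0)];
         [:: (1,1); (0,0); (0,0); (0,0); (1,0); (0,0); (1,0); (1,0); (0,-1)]]%ZZ);
      ([:: 1; 5; 6; 8]%N,
     [:: [:: (1,0); (0,0); (0,0); (0,0); (1,0); (0,0); (1,0); (1,0); (1,0)];
         [:: (0,0); (1,0); (0,0); (0,0); (1,0); (1,0); (0,1); (0,1); (1,1)];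
         [:: (0,0); (0,0); (1,0); (0,0); (1,0); (1,0); (1,0); (-1,1); (0,1)];
         [:: (0,0); (0,0); (0,0); (1,0); (0,0); (0,1); (1,0); (0,0); (0,0)]]%ZZ);
      ([:: 2; 3; 6; 7]%N,
     [:: [:: (1,0); (0,0); (0,0); (0,0); (1,0); (0,0); (1,0); (1,0); (1,0)];
         [:: (0,0); (1,0); (0,0); (1,0); (1,0); (0,0); (1,0); (0,1); (-1,1)];
         [:: (0,0); (0,0); (1,0); (1,0); (1,0); (0,0); (0,1); (1,1); (0,1)];
         [:: (0,0); (0,0); (0,0); (0,1); (0,0); (1,0); (1,0); (0,0); (0,0)]]%ZZ)].

(** The first item is the tightening: columns 0, 1, 2 form a basis of [P1] but are dependent
    here. *)
Definition relaxP1 : seq (seq nat * seq (seq (Z * Z))) :=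
  [:: ([:: 0; 1; 2]%N,
     [:: [:: (1,0); (0,0); (1,0); (0,0); (1,0); (1,0); (0,0); (1,0); (1,0)];
         [:: (0,0); (1,0); (1,0); (0,0); (0,0); (0,0); (1,0); (2,0); (1,0)];
         [:: (0,0); (0,0); (0,0); (1,0); (1,0); (2,0); (2,0); (1,0); (2,0)]]%ZZ);
      ([:: 1; 3; 6]%N,
     [:: [:: (1,0); (0,0); (0,0); (1,0); (1,0); (1,0); (1,0); (1,0); (1,0)];
         [:: (0,0); (1,0); (0,0); (1,0); (1,1); (0,1); (1,1); (0,1); (1,0)];
         [:: (0,0); (0,0); (1,0); (1,0); (1,1); (0,1); (1,2); (1,1); (0,1)]]%ZZ);
      ([:: 1; 4; 7]%N,
     [:: [:: (1,0); (0,0); (0,0); (1,0); (1,0); (1,0); (1,0); (1,0); (1,0)];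
         [:: (0,0); (1,0); (0,0); (1,0); (2,1); (0,1); (2,1); (0,1); (1,0)];
         [:: (0,0); (0,0); (1,0); (1,0); (2,1); (0,1); (1,0); (1,1); (0,1)]]%ZZ);
      ([:: 1; 5; 8]%N,
     [:: [:: (1,0); (0,0); (0,0); (1,0); (1,0); (1,0); (1,0); (1,0); (1,0)];
         [:: (0,0); (1,0); (0,0); (1,0); (0,1); (1,1); (0,1); (1,1); (1,0)];
         [:: (0,0); (0,0); (1,0); (1,0); (0,1); (1,1); (1,0); (0,1); (2,1)]]%ZZ);
      ([:: 2; 3; 8]%N,
     [:: [:: (1,0); (0,0); (0,0); (1,0); (1,0); (1,0); (1,0); (1,0); (1,0)];
         [:: (0,0); (1,0); (0,0); (1,0); (0,1); (1,1); (0,1); (1,1); (1,2)];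
         [:: (0,0); (0,0); (1,0); (1,0); (0,1); (1,1); (1,0); (0,1); (1,1)]]%ZZ)].

Definition relaxP2 : seq (seq nat * seq (seq (Z * Z))) :=
  [:: ([:: 0; 1; 3; 6]%N,
     [:: [:: (1,0); (0,0); (0,0); (0,0); (1,0); (0,0); (1,0); (1,0)];
         [:: (0,0); (1,0); (0,0); (0,0); (1,0); (1,0); (2,1); (2,1)];
         [:: (0,0); (0,0); (1,0); (0,0); (1,0); (0,1); (1,1); (1,0)];
         [:: (0,0); (0,0); (0,0); (1,0); (1,0); (1,1); (1,0); (0,0)]]%ZZ);
      ([:: 2; 4; 5; 7]%N,
     [:: [:: (1,0); (0,0); (0,0); (0,0); (1,0); (0,0); (1,0); (1,0)];
         [:: (0,0); (1,0); (0,0); (0,0); (1,0); (1,0); (0,1); (0,1)];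
         [:: (0,0); (0,0); (1,0); (0,0); (1,0); (2,1); (0,0); (1,0)];
         [:: (0,0); (0,0); (0,0); (1,0); (1,0); (2,0); (1,0); (0,0)]]%ZZ)].

Definition relaxP3 : seq (seq nat * seq (seq (Z * Z))) :=
  [:: ([:: 0; 7; 8]%N,
     [:: [:: (1,0); (0,0); (0,0); (0,0); (1,0); (1,0); (1,0); (1,0); (1,0)];
         [:: (0,0); (1,0); (0,0); (1,0); (1,0); (0,2); (2,1); (0,2); (2,1)];
         [:: (0,0); (0,0); (1,0); (1,0); (2,0); (0,1); (1,2); (2,0); (0,1)]]%ZZ);
      ([:: 1; 2; 3]%N,
     [:: [:: (1,0); (0,0); (0,0); (1,0); (1,0); (1,0); (1,0); (1,0); (1,0)];
         [:: (0,0); (1,0); (0,0); (1,0); (2,0); (0,1); (2,2); (0,1); (2,2)];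
         [:: (0,0); (0,0); (1,0); (1,0); (0,2); (1,1); (2,1); (0,2); (1,1)]]%ZZ);
      ([:: 1; 4; 7]%N,
     [:: [:: (1,0); (0,0); (0,0); (0,0); (1,0); (1,0); (1,0); (1,0); (1,0)];
         [:: (0,0); (1,0); (0,0); (1,0); (1,0); (1,1); (0,1); (1,1); (0,1)];
         [:: (0,0); (0,0); (1,0); (1,0); (2,2); (1,0); (2,1); (0,1); (1,0)]]%ZZ);
      ([:: 1; 5; 8]%N,
     [:: [:: (1,0); (0,0); (0,0); (0,0); (1,0); (1,0); (1,0); (1,0); (1,0)];
         [:: (0,0); (1,0); (0,0); (1,0); (1,0); (1,1); (0,2); (1,1); (0,2)];
         [:: (0,0); (0,0); (1,0); (1,0); (0,1); (1,2); (2,2); (0,1); (2,0)]]%ZZ);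
      ([:: 2; 6; 8]%N,
     [:: [:: (1,0); (0,0); (0,0); (0,0); (1,0); (1,0); (1,0); (1,0); (1,0)];
         [:: (0,0); (1,0); (0,0); (1,0); (1,0); (2,1); (0,1); (2,1); (2,2)];
         [:: (0,0); (0,0); (1,0); (1,0); (0,1); (1,0); (1,1); (0,1); (1,0)]]%ZZ)].

(** Here [(0,1)] is a primitive cube root of unity and [(-1,-1)] its square. *)
Definition eisensteinP1 : seq (seq (Z * Z)) :=
  [:: [:: (1,0); (0,0); (0,0); (1,0); (1,0); (1,0); (1,0); (1,0); (1,0)];
      [:: (0,0); (1,0); (0,0); (1,0); (0,1); (-1,-1); (0,1); (-1,-1); (1,0)];
      [:: (0,0); (0,0); (1,0); (1,0); (0,1); (-1,-1); (1,0); (0,1); (-1,-1)]]%ZZ.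

Definition eisensteinP2 : seq (seq (Z * Z)) :=
  [:: [:: (1,0); (0,0); (0,0); (0,0); (1,0); (0,0); (1,-1); (1,-1)];
      [:: (0,0); (1,0); (0,0); (0,0); (1,0); (1,0); (1,0); (1,0)];
      [:: (0,0); (0,0); (1,0); (0,0); (1,0); (1,-1); (0,0); (1,-1)];
      [:: (0,0); (0,0); (0,0); (1,0); (1,0); (2,1); (1,-1); (0,0)]]%ZZ.

Definition eisensteinP3 : seq (seq (Z * Z)) :=
  [:: [:: (1,0); (0,0); (0,0); (0,0); (1,0); (1,0); (1,0); (1,0); (1,0)];
      [:: (0,0); (1,0); (0,0); (1,0); (1,0); (-1,-1); (0,1); (-1,-1); (0,1)];
      [:: (0,0); (0,0); (1,0); (1,0); (0,-1); (-1,0); (1,1); (0,-1); (-1,0)]]%ZZ.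

Lemma relaxV1_ok : qrelaxations 3 9 gf4 golden dV1 relaxV1.
Proof. by vm_compute. Qed.
Lemma relaxV2_ok : qrelaxations 4 8 gf4 golden dV2 relaxV2.
Proof. by vm_compute. Qed.
Lemma relaxV3_ok : qrelaxations 4 9 gf4 golden dV3 relaxV3.
Proof. by vm_compute. Qed.
Lemma relaxP1_ok : qrelaxations 3 9 gf4 golden3 dP1 relaxP1.
Proof. by vm_compute. Qed.
Lemma relaxP2_ok : qrelaxations 4 8 gf4 golden3 dP2 relaxP2.
Proof. by vm_compute. Qed.
Lemma relaxP3_ok : qrelaxations 3 9 gf4 golden3 dP3 relaxP3.
Proof. by vm_compute. Qed.

Definition qequal r n R1 R2 d1 d2 :=
  [&& (0 < r)%N, qagree r n R1 R2 d1 d2 [::] &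
      has (fun s => qbasis R1 r d1 s == Some true) (comb r (iota 0 n))].

Lemma eisensteinP1_ok : qequal 3 9 gf4 eisenstein dP1 eisensteinP1.
Proof. by vm_compute. Qed.
Lemma eisensteinP2_ok : qequal 4 8 gf4 eisenstein dP2 eisensteinP2.
Proof. by vm_compute. Qed.
Lemma eisensteinP3_ok : qequal 3 9 gf4 eisenstein dP3 eisensteinP3.
Proof. by vm_compute. Qed.

(** The permutation exchanges columns 2 and 5. *)
Lemma V2_self_dual_ok : qself_dual gf4 4 8 dV2 [:: 0; 1; 5; 3; 4; 2; 6; 7].
Proof. by vm_compute. Qed.
(** The permutation exchanges 0 with 1, 2 with 5, 3 with 6 and 4 with 7. *)
Lemma P2_self_dual_ok : qself_dual gf4 4 8 dP2 [:: 1; 0; 5; 6; 7; 2; 3; 4].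
Proof. by vm_compute. Qed.

(** * Characteristic sets and excluded minors *)

Lemma has_char_natr0 (F : fieldType) (k p : nat) :
  has_char F k -> prime p -> p%:R = 0 :> F -> k = p.
Proof.
move=> Fk pp p0; have pF : p \in [pchar F] by rewrite inE pp p0 eqxx.
move: Fk; rewrite /has_char; case: eqP => [_ F0|_ kF].
  by have := F0 p; rewrite pF.
by apply/eqP; rewrite -[_ == _]/(k \in pred1 p) -(pcharf_eq pF).
Qed.

Lemma has_char_prime (F : fieldType) (k : nat) :
  has_char F k -> prime k \/ k = 0%N.
Proof.
rewrite /has_char; case: eqP => [-> _|_ /pcharf_prime]; first by right.
by left.
Qed.

Lemma has_char_natr (F : fieldType) (k : nat) : has_char F k -> k%:R = 0 :> F.
Proof. by rewrite /has_char; case: eqP => [-> //|_ /pcharf0]. Qed.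

Lemma golden_model (F : fieldType) (t : F) : t ^+ 2 = t + 1 -> qmodel golden t.
Proof. by move=> t2; split; rewrite ?mul1r // oner_neq0. Qed.

Lemma golden3_model (F : fieldType) (t : F) :
  has_char F 3%N -> t ^+ 2 = t + 1 -> qmodel golden3 t.
Proof.
move=> F3 t2; split; rewrite ?mul1r ?oner_neq0 //.
by rewrite (zeval_nat F 3) (has_char_natr F3).
Qed.

Lemma eisenstein_model (F : fieldType) (t : F) :
  3%:R != 0 :> F -> t ^+ 2 = - t - 1 -> qmodel eisenstein t.
Proof.
move=> F3 t2; split; rewrite /= ?(zeval_nat F 3) //.
by rewrite t2 (zevalN F 1) mulN1r.
Qed.

Section GF4.
Variables (GF4 : finFieldType) (card_GF4 : #|GF4| = 4%N)
  (alpha : GF4) (alphaE : alpha ^+ 2 = alpha + 1).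

Lemma GF4_char : has_char GF4 2%N.
Proof. exact: (@card_finPcharP _ 2 2). Qed.

Lemma gf4_model : qmodel gf4 alpha.
Proof.
split; rewrite ?mul1r ?oner_neq0 //.
by rewrite (zeval_nat GF4 2) (has_char_natr GF4_char).
Qed.

Lemma mx_of_rows_qmx r n d :
  mx_of_rows r n (map (map (qeval alpha)) d) = qmx alpha r n d.
Proof.
(* Out of range, the default [(0, 0)] of one side must evaluate to the default 0 of the other. *)
have q0 : qeval alpha (0, 0)%ZZ = 0 by rewrite /qeval mul0r addr0.
apply/matrixP => i j; rewrite !mxE.
have [id|id] := ltnP i (size d); last first.
  by rewrite !(nth_default _ id) ?nth_default ?size_map ?nth_nil.
rewrite (nth_map [::]) //.
have [jd|jd] := ltnP j (size (nth [::] d i)); first by rewrite (nth_map (0, 0)%ZZ).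
by rewrite [RHS](f_equal _ (nth_default _ jd)) q0 nth_default ?size_map.
Qed.

Lemma qevalE : (((qeval alpha (0, 0)%ZZ = 0) * (qeval alpha (1, 0)%ZZ = 1)) *
  ((qeval alpha (0, 1)%ZZ = alpha) * (qeval alpha (1, 1)%ZZ = alpha ^+ 2)))%type.
Proof.
have z0 : zeval GF4 0 = 0 by []; have z1 : zeval GF4 1 = 1 by [].
rewrite /qeval /= z0 z1 !mul0r !mul1r !addr0 add0r alphaE [1 + alpha]addrC.
by [].
Qed.

Lemma V1E : V1 alpha = column_matroid (qmx alpha 3 9 dV1).
Proof. by rewrite -mx_of_rows_qmx /= !qevalE. Qed.
Lemma V2E : V2 alpha = column_matroid (qmx alpha 4 8 dV2).
Proof. by rewrite -mx_of_rows_qmx /= !qevalE. Qed.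
Lemma V3E : V3 alpha = column_matroid (qmx alpha 4 9 dV3).
Proof. by rewrite -mx_of_rows_qmx /= !qevalE. Qed.
Lemma P1E : P1 alpha = column_matroid (qmx alpha 3 9 dP1).
Proof. by rewrite -mx_of_rows_qmx /= !qevalE. Qed.
Lemma P2E : P2 alpha = column_matroid (qmx alpha 4 8 dP2).
Proof. by rewrite -mx_of_rows_qmx /= !qevalE. Qed.
Lemma P3E : P3 alpha = column_matroid (qmx alpha 3 9 dP3).
Proof. by rewrite -mx_of_rows_qmx /= !qevalE. Qed.

Variables (r n : nat) (d : seq (seq (Z * Z))).
Let M := column_matroid (qmx alpha r n d).

Lemma char_set_two :
  (forall F : fieldType, representable F M -> 2%:R = 0 :> F) ->
  forall k, char_set M k <-> k = 2%N.
Proof.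
move=> two k; split=> [[F Fk /two F2]|->]; first exact: has_char_natr0 Fk _ F2.
by exists GF4; [exact: GF4_char | exact: representable_column].
Qed.

Lemma proper_minor_GF4 N : proper_minor N M -> representable GF4 N.
Proof. by move=> [C [D [_ _ _ _ ->]]]; apply: minor_representable. Qed.

(** Characteristic 0 is missing for [M]. For a proper minor, a closed field of the wanted
    characteristic contains a root of [t^2 = t + 1], over which the relaxations in [L] represent
    it. *)
Lemma excluded_minor_two L :
  (forall F : fieldType, representable F M -> 2%:R = 0 :> F) ->
  qrelaxations r n gf4 golden d L -> excluded_minor (all_char GF4) M.
Proof.
move=> two ok; split=> [[_ /(_ 0%N (or_intror erefl))]|N NM].
  by move=> /(char_set_two two).
split=> [|k /closed_field_of_char[K Kk /(_ 1 1)[t t2]]].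
  exact: proper_minor_GF4.
exists K => //; apply: (qrelaxations_minor gf4_model _ ok NM).
by apply: (@golden_model _ t); rewrite t2 mul1r.
Qed.

(** A closed field contains a root of [t^2 + t + 1], and 3 is nonzero in it by the choice of [k]. *)
Lemma eisenstein_field d' k : qequal r n gf4 eisenstein d d' ->
  (prime k /\ k <> 3%N) \/ k = 0%N ->
  exists (K : fieldType) (t : K), [/\ has_char K k, qmodel eisenstein t &
    column_indep (qmx alpha r n d) = column_indep (qmx t r n d')].
Proof.
move=> /and3P[r0 ag bs] kP.
have [|K Kk /(_ (-1) (-1))[t t2]] := @closed_field_of_char k.
  by case: kP => [[]|]; [left | right].
have tm : qmodel eisenstein t.
  apply: eisenstein_model; last by rewrite t2 mulN1r.
  apply/eqP => K3; have k3 := has_char_natr0 Kk (isT : prime 3) K3.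
  by case: kP => [[_]|]; rewrite k3.
exists K, t; split=> //.
exact: (qagree_column_indep gf4_model tm r0 ag bs).
Qed.

Lemma char_set_not3 d' :
  (forall F : fieldType, representable F M -> 3%:R != 0 :> F) ->
  qequal r n gf4 eisenstein d d' ->
  forall k, char_set M k <-> (prime k /\ k <> 3%N) \/ k = 0%N.
Proof.
move=> three eq k; split=> [[F Fk /three F3]|kP].
  have [pk|->] := has_char_prime Fk; [left | by right].
  by split=> // k3; move: F3; rewrite -k3 (has_char_natr Fk) eqxx.
have [K [t [Kk _ eqI]]] := eisenstein_field eq kP.
exists K => //.
apply: (@representable_eq _ _ (column_matroid (qmx t r n d')));
  [by [] | exact: esym | exact: representable_column].
Qed.

(** Characteristic 3 is missing for [M]. A proper minor obtains it from the relaxations in [L], and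
    every other characteristic from the representation [d'] of [M] itself. *)
Lemma excluded_minor_not3 d' L :
  (forall F : fieldType, representable F M -> 3%:R != 0 :> F) ->
  qequal r n gf4 eisenstein d d' ->
  qrelaxations r n gf4 golden3 d L -> excluded_minor (all_char GF4) M.
Proof.
move=> three eq ok; split=> [[_ /(_ 3%N (or_introl isT))]|N NM].
  by move=> /(char_set_not3 three eq)[[]|].
split=> [|k kP]; first exact: proper_minor_GF4.
have [k3|k3] := eqVneq k 3%N.
  have [K Kk /(_ 1 1)[t t2]] := closed_field_of_char kP.
  exists K => //; apply: (qrelaxations_minor gf4_model _ ok NM).
  by apply: (@golden3_model _ t); rewrite -?k3 // t2 mul1r.
have {}kP : (prime k /\ k <> 3%N) \/ k = 0%N.
  by case: kP => [pk|->]; [left; split=> //; apply/eqP | right].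
have [K [t [Kk _ eqI]]] := eisenstein_field eq kP.
exists K => //; case: NM => C [D [_ _ _ _ ->]].
exact: eq_column_minor_representable eqI.
Qed.

End GF4.

Local Close Scope ring_scope.

Theorem theorem5p3 (GF4 : finFieldType) (card_GF4 : #|GF4| = 4)
    (alpha : GF4) (alphaE : (alpha ^+ 2 = alpha + 1)%R) :
  [/\ forall k : nat, char_set (V1 alpha) k <-> k = 2,
      forall k : nat, char_set (V2 alpha) k <-> k = 2
    & forall k : nat, char_set (V3 alpha) k <-> k = 2] /\
  [/\ forall k : nat, char_set (P1 alpha) k <-> (prime k /\ k <> 3) \/ k = 0,
      forall k : nat, char_set (P2 alpha) k <-> (prime k /\ k <> 3) \/ k = 0
    & forall k : nat, char_set (P3 alpha) k <-> (prime k /\ k <> 3) \/ k = 0] /\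
  [/\ excluded_minor (all_char GF4) (V1 alpha),
      excluded_minor (all_char GF4) (V2 alpha)
    & excluded_minor (all_char GF4) (V3 alpha)] /\
  [/\ excluded_minor (all_char GF4) (P1 alpha),
      excluded_minor (all_char GF4) (P2 alpha)
    & excluded_minor (all_char GF4) (P3 alpha)] /\
  isomorphic (V2 alpha) (dual (V2 alpha)) /\
  isomorphic (P2 alpha) (dual (P2 alpha)).
Proof.
have am := gf4_model card_GF4 alphaE.
rewrite (V1E alphaE) (V2E alphaE) (V3E alphaE).
rewrite (P1E alphaE) (P2E alphaE) (P3E alphaE).
have v1 F := V1_two am (F := F); have v2 F := V2_two am (F := F).
have v3 F := V3_two am (F := F); have p1 F := P1_three am (F := F).
have p2 F := P2_three am (F := F); have p3 F := P3_three am (F := F).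
split; [|split; [|split; [|split; [|split]]]].
- by split; apply: char_set_two.
- split; [apply: char_set_not3 p1 eisensteinP1_ok
         |apply: char_set_not3 p2 eisensteinP2_ok
         |apply: char_set_not3 p3 eisensteinP3_ok] => //.
- split; [apply: excluded_minor_two v1 relaxV1_ok
         |apply: excluded_minor_two v2 relaxV2_ok
         |apply: excluded_minor_two v3 relaxV3_ok] => //.
- split; [apply: excluded_minor_not3 p1 eisensteinP1_ok relaxP1_ok
         |apply: excluded_minor_not3 p2 eisensteinP2_ok relaxP2_ok
         |apply: excluded_minor_not3 p3 eisensteinP3_ok relaxP3_ok] => //.
- exact: qself_dualP am V2_self_dual_ok.
- exact: qself_dualP am P2_self_dual_ok.
Qed.
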